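(* The map $C\mapsto\mathfrak{L}_\bullet(C)$ (acting on a homomorphism of compatible sequences $\phi=(\phi^{(n)})$ by applying the $\phi^{(n)}$ entrywise to stable sequences) is a covariant functor from the category $\mathfrak{C}$ of compatible sequences to the category $\mathbb{B}_{q,t}\text{-}\mathrm{Mod}$ of graded left $\mathbb{B}_{q,t}$-modules.
   Context: Base field $\mathbb{Q}(q,t)$ with $q,t$ algebraically independent over $\mathbb{Q}$. ''Graded'' means $\mathbb{Z}_{\ge0}$-graded; morphisms of graded modules are degree-preserving. **Positive DAHA.** $\mathscr{D}_n^{+}$ is the $\mathbb{Q}(q,t)$-algebra generated by $T_1,\dots,T_{n-1}$, $X_1,\dots,X_n$, $Y_1,\dots,Y_n$ with relations: $(T_i-1)(T_i+q)=0$; $T_iT_{i+1}T_i=T_{i+1}T_iT_{i+1}$; $T_iT_j=T_jT_i$ for $|i-j|>1$; $T_i^{-1}X_iT_i^{-1}=q^{-1}X_{i+1}$; $T_iX_j=X_jT_i$ for $j\notin\{i,i+1\}$; $X_iX_j=X_jX_i$; $T_iY_iT_i=qY_{i+1}$; $T_iY_j=Y_jT_i$ for $j\notin\{i,i+1\}$; $Y_iY_j=Y_jY_i$; $Y_1T_1X_1=X_2Y_1T_1$; $Y_1X_1\cdots X_n=tX_1\cdots X_nY_1$. It is graded by $\deg T_i=\deg Y_i=0$, $\deg X_i=1$. $\mathscr{A}_n^X$ is the subalgebra generated by the $T_i$ and $X_i$; it is naturally included in $\mathscr{A}_{n+1}^X$. Put $\pi^{(n)}=q^{-n}Y_1T_1\cdots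 T_{n-1}\in\mathscr{D}_n^+$. For $0\le k\le n$, $\epsilon_k=\epsilon_k^{(n)}=\frac{1}{[n-k]_q!}\sum_{\sigma\in\mathfrak{S}_{(1^k,n-k)}}q^{\binom{n-k}{2}-\ell(\sigma)}T_\sigma$, where $\mathfrak{S}_{(1^k,n-k)}\subset\mathfrak{S}_n$ is the Young subgroup of $(1^k,n-k)$, $T_\sigma=T_{i_1}\cdots T_{i_r}$ for a reduced expression $\sigma=s_{i_1}\cdots s_{i_r}$, $[m]_q!=\prod_{i=1}^m\frac{1-q^i}{1-q}$. **The algebra $\mathbb{B}_{q,t}$.** It is the path algebra generated by orthogonal idempotents $e_k$ ($k\in\mathbb{Z}_{\ge0}$) and, at each vertex $k$, generators $T_1,\dots,T_{k-1}$ and $z_1,\dots,z_k$ (from $k$ to $k$), $d_+$ (from $k$ to $k+1$), $d_-$ (from $k$ to $k-1$, for $k\ge1$), modulo the following relations (where $k$ denotes the source vertex, operators composing right to left): $(T_i-1)(T_i+q)=0$; $T_iT_{i+1}T_i=T_{i+1}T_iT_{i+1}$; $T_iT_j=T_jT_i$ if $|i-j|>1$; $T_i^{-1}z_{i+1}T_i^{-1}=q^{-1}z_i$ for $1\le i\le k-1$; $z_iT_j=T_jz_i$ if $i\notin\{j,j+1\}$; $z_iz_j=z_jz_i$ for $1\le i,j\le k$; $d_-^2T_{k-1}=d_-^2$ for $k\ge2$; $d_-T_i=T_id_-$ for $1\le i\le k-2$; $T_1d_+^2=d_+^2$; $d_+T_i=T_{i+1}d_+$ for $1\le i\le k-1$;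 $q\varphi d_-=d_-\varphi T_{k-1}$ for $k\ge2$; $T_1\varphi d_+=qd_+\varphi$ for $k\ge1$; $z_id_-=d_-z_i$ (for $1\le i\le k-1$); $d_+z_i=z_{i+1}d_+$ (for $1\le i\le k$); $z_1(qd_+d_--d_-d_+)=qt(d_+d_--d_-d_+)z_k$ for $k\ge1$; where $\varphi=\frac{1}{q-1}[d_+,d_-]$. It is graded by $\deg T_i=\deg z_i=\deg d_-=0$, $\deg d_+=1$. $\mathbb{B}_{q,t}^{(n)}$ is the subalgebra given by only considering $T_i,z_i,d_-,d_+$ between the idempotents labelled $0,\dots,n$; $\mathbb{B}_{q,t}=\lim_{\rightarrow}\mathbb{B}_{q,t}^{(n)}$. **The module $L_\bullet(V)$.** For a graded $\mathscr{D}_n^{+}$-module $V$ put $L_k(V)=X_1\cdots X_k\,\epsilon_k(V)\subset V$ and $L_\bullet(V)=\bigoplus_{0\le k\le n}L_k(V)$ (grading inherited from $V$). It is a graded $\mathbb{B}_{q,t}^{(n)}$-module with $e_k$ the projection onto $L_k(V)$ and, for $v\in L_k(V)$: $T_i(v)=T_iv$; $z_i(v)=(qt)^{-1}Y_iv$; $d_+(v)=q^kX_1T_1^{-1}\cdots T_k^{-1}v\in L_{k+1}(V)$ ($k\le n-1$); $d_-(v)=(q-1)(1+qT_k^{-1}+\cdots+q^{n-k}T_{n-1}^{-1}\cdots T_k^{-1})v\in L_{k-1}(V)$ ($k\ge1$). **Compatible sequences.** A compatible sequence $C=((V^{(n)})_{n\ge n_1},(\Pi^{(n)})_{n\ge n_1})$,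 $n_1\ge1$, consists of graded $\mathscr{D}_n^{+}$-modules $V^{(n)}$ and degree-preserving maps $\Pi^{(n)}:V^{(n+1)}\to V^{(n)}$ such that each $\Pi^{(n)}$ is an $\mathscr{A}_n^X$-module map, $\Pi^{(n)}X_{n+1}=0$, and $\Pi^{(n)}\pi^{(n+1)}T_n=\pi^{(n)}\Pi^{(n)}$. A homomorphism from $C$ to $D=((W^{(n)})_{n\ge n_2},(\Psi^{(n)})_{n\ge n_2})$ is a family $\phi=(\phi^{(n)})_{n\ge\max(n_1,n_2)}$ of degree-preserving $\mathscr{D}_n^{+}$-module maps $\phi^{(n)}:V^{(n)}\to W^{(n)}$ with $\phi^{(n)}\Pi^{(n)}=\Psi^{(n)}\phi^{(n+1)}$. $\mathfrak{C}$ is the category of compatible sequences. **Stable-limits.** For graded spaces $U^{(n)}$ and degree-preserving maps $\Pi^{(n)}:U^{(n+1)}\to U^{(n)}$ ($n\ge n_0$), $\lim_{\leftarrow}U^{(n)}=\bigoplus_{d\ge0}\{(v_n)_{n\ge n_0}\in\prod_nU^{(n)}(d):\Pi^{(n)}(v_{n+1})=v_n\}$, where $U(d)$ is the degree $d$ component. For a compatible sequence $C$, $\Pi^{(n)}(L_k(V^{(n+1)}))\subset L_k(V^{(n)})$ for $0\le k\le n$; set $\mathfrak{L}_k(C)=\lim_{\leftarrow}L_k(V^{(n)})$ with respect to the $\Pi^{(n)}$ (over $n\ge\max(n_1,k)$) and $\mathfrak{L}_\bullet(C)=\bigoplus_{k\ge0}\mathfrak{L}_k(C)$. The $\mathbb{B}_{q,t}$-action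 on $\mathfrak{L}_\bullet(C)$ is the stable-limit of the $\mathbb{B}_{q,t}^{(n)}$-actions on $L_\bullet(V^{(n)})$: for $r\in\mathbb{B}_{q,t}^{(N)}$ and a stable sequence $v=(v_n)$, the $n$-th entry of $r(v)$ is $r(v_n)$ for $n\ge N$ and $\Pi^{(n)}\cdots\Pi^{(N-1)}(r(v_N))$ for $n<N$.
   Formalization: The relation π^{(n)}X_n = tX_1π^{(n)} is added to the presentation of the positive DAHA, without which the claim fails; homomorphisms may start at any n ≥ max(n_1,n_2) and are identified when equal for large n, since the stated families are not closed under composition. *)

(* Defs.v *)
From HB Require Import structures.
From mathcomp Require Import all_boot all_order all_fingroup all_algebra.
From mathcomp Require Import boolp classical_sets.

Set Implicit Arguments.
Unset Strict Implicit.
Unset Printing Implicit Defensive.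

Import GRing.Theory.
Local Open Scope ring_scope.
Local Open Scope quotient_scope.

(* Algebras given by generators and relations, possibly without unit.         *)
(* [palg P] is the algebra of formal expressions in the generators of [P]     *)
(* modulo the smallest congruence containing the relations of [P] and the     *)
(* axioms of associative K-algebras.  When [punital P] is false there is no   *)
(* constant 1, and [palg P] is the non-unital presented algebra.              *)

Inductive expr (K : Type) (u : bool) (G : Type) : Type :=
| EGen of G
| EZero
| EOne of u
| EOpp of expr K u G
| EAdd of expr K u G & expr K u G
| EScale of K & expr K u G
| EMul of expr K u G & expr K u G.
Arguments EGen {K u G}.
Arguments EZero {K u G}.
Arguments EOne {K u G}.

Declare Scope expr_scope.
Delimit Scope expr_scope with X.
Bind Scope expr_scope with expr.
Notation "0" := EZero : expr_scope.
Notation "1" := (EOne isT) : expr_scope.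
Notation "a + b" := (EAdd a b) : expr_scope.
Notation "a - b" := (EAdd a (EOpp b)) : expr_scope.
Notation "c *: a" := (EScale c%R a) : expr_scope.
Notation "a * b" := (EMul a b) : expr_scope.

Record presentation (K : fieldType) := Presentation {
  punital : bool;
  pgen : Type;
  pdeg : pgen -> nat;
  prel : expr K punital pgen -> expr K punital pgen -> Prop }.

Definition pexpr (K : fieldType) (P : presentation K) : Type :=
  {classic expr K (punital P) (pgen P)}.
Bind Scope expr_scope with pexpr.

Section PresentedAlgebra.
Variables (K : fieldType) (P : presentation K).
Local Notation E := (expr K (punital P) (pgen P)).

Inductive pcong : E -> E -> Prop :=
| pc_rel a b : prel a b -> pcong a b
| pc_refl a : pcong a a
| pc_sym a b : pcong a b -> pcong b a
| pc_trans a b c : pcong a b -> pcong b c -> pcong a c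
| pc_opp a b : pcong a b -> pcong (EOpp a) (EOpp b)
| pc_add a b c d : pcong a b -> pcong c d -> pcong (a + c)%X (b + d)%X
| pc_scale k a b : pcong a b -> pcong (k *: a)%X (k *: b)%X
| pc_mul a b c d : pcong a b -> pcong c d -> pcong (a * c)%X (b * d)%X
| pc_addA a b c : pcong (a + (b + c))%X ((a + b) + c)%X
| pc_addC a b : pcong (a + b)%X (b + a)%X
| pc_add0 a : pcong (0 + a)%X a
| pc_addN a : pcong (EOpp a + a)%X 0%X
| pc_scaleA k l a : pcong (k *: (l *: a))%X ((k * l)%R *: a)%X
| pc_scale1 a : pcong (1%R *: a)%X a
| pc_scaleDr k a b : pcong (k *: (a + b))%X (k *: a + k *: b)%X
| pc_scaleDl k l a : pcong ((k + l)%R *: a)%X (k *: a + l *: a)%X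
| pc_mulA a b c : pcong (a * (b * c))%X ((a * b) * c)%X
| pc_mulDl a b c : pcong ((a + b) * c)%X (a * c + b * c)%X
| pc_mulDr a b c : pcong (a * (b + c))%X (a * b + a * c)%X
| pc_scaleAl k a b : pcong ((k *: a) * b)%X (k *: (a * b))%X
| pc_scaleAr k a b : pcong (a * (k *: b))%X (k *: (a * b))%X
| pc_mul1l h a : pcong (EOne h * a)%X a
| pc_mul1r h a : pcong (a * EOne h)%X a.

Definition pcongb : rel (pexpr P) := fun a b => `[< pcong a b >].

Lemma pcongb_equiv : equiv_class_of pcongb.
Proof.
split.
- by move=> a; apply/asboolP; apply: pc_refl.
- by move=> a b; apply/asboolP/asboolP; apply: pc_sym.
- by move=> b a c /asboolP ab /asboolP bc; apply/asboolP; apply: pc_trans bc.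
Qed.

Canonical pcong_equiv_rel := EquivRelPack pcongb_equiv.

Definition palg := {eq_quot pcong_equiv_rel}.
HB.instance Definition _ := Choice.on palg.

Definition pcl (e : E) : palg := \pi_palg (e : pexpr P).

Lemma pclP (a b : E) : pcl a = pcl b <-> pcong a b.
Proof. by split=> [/eqP|h]; [rewrite eqmodE => /asboolP|apply/eqP; rewrite eqmodE; apply/asboolP]. Qed.

Definition prep (x : palg) : E := generic_quotient.repr x.

Lemma prepK x : pcl (prep x) = x.
Proof. exact: reprK. Qed.

Lemma prep_pcl e : pcong (prep (pcl e)) e.
Proof. by apply/pclP; rewrite prepK. Qed.

Definition padd (x y : palg) : palg := pcl (prep x + prep y)%X.
Definition popp (x : palg) : palg := pcl (EOpp (prep x)).
Definition pscale (k : K) (x : palg) : palg := pcl (k *: prep x)%X.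
Definition pmul (x y : palg) : palg := pcl (prep x * prep y)%X.
Definition pone (h : punital P) : palg := pcl (EOne h).

Lemma pcl_add a b : pcl (a + b)%X = padd (pcl a) (pcl b).
Proof. by apply/pclP; apply: pc_add; apply: pc_sym; apply: prep_pcl. Qed.
Lemma pcl_opp a : pcl (EOpp a) = popp (pcl a).
Proof. by apply/pclP; apply: pc_opp; apply: pc_sym; apply: prep_pcl. Qed.
Lemma pcl_scale k a : pcl (k *: a)%X = pscale k (pcl a).
Proof. by apply/pclP; apply: pc_scale; apply: pc_sym; apply: prep_pcl. Qed.
Lemma pcl_mul a b : pcl (a * b)%X = pmul (pcl a) (pcl b).
Proof. by apply/pclP; apply: pc_mul; apply: pc_sym; apply: prep_pcl. Qed.

Fact paddA : associative padd.
Proof.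
move=> x y z; rewrite -(prepK x) -(prepK y) -(prepK z) -!pcl_add.
by apply/pclP; apply: pc_addA.
Qed.
Fact paddC : commutative padd.
Proof.
by move=> x y; rewrite -(prepK x) -(prepK y) -!pcl_add; apply/pclP/pc_addC.
Qed.
Fact padd0 : left_id (pcl 0%X) padd.
Proof. by move=> x; rewrite -(prepK x) -!pcl_add; apply/pclP/pc_add0. Qed.
Fact paddN : left_inverse (pcl 0%X) popp padd.
Proof.
by move=> x; rewrite -(prepK x) -pcl_opp -!pcl_add; apply/pclP/pc_addN.
Qed.
HB.instance Definition _ := GRing.isZmodule.Build palg paddA paddC padd0 paddN.

Lemma pcl_surj x : exists e, x = pcl e.
Proof. by exists (prep x); rewrite prepK. Qed.

Lemma pclD a b : pcl (a + b)%X = pcl a + pcl b.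
Proof. exact: pcl_add. Qed.

Fact pscaleA k l x : pscale k (pscale l x) = pscale (k * l) x.
Proof. by have [a ->] := pcl_surj x; rewrite -!pcl_scale; apply/pclP/pc_scaleA. Qed.
Fact pscale1 : left_id 1 pscale.
Proof.
by move=> x; have [a ->] := pcl_surj x; rewrite -!pcl_scale; apply/pclP/pc_scale1.
Qed.
Fact pscaleDr : right_distributive pscale +%R.
Proof.
move=> k x y; have [[a ->] [b ->]] := (pcl_surj x, pcl_surj y).
by rewrite -pclD -!pcl_scale -pclD; apply/pclP/pc_scaleDr.
Qed.
Fact pscaleDl x : {morph pscale^~ x : k l / k + l}.
Proof.
move=> k l; have [a ->] := pcl_surj x.
by rewrite -!pcl_scale -pclD; apply/pclP/pc_scaleDl.
Qed.
HB.instance Definition _ :=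
  GRing.Zmodule_isLmodule.Build K palg pscaleA pscale1 pscaleDr pscaleDl.

Lemma pclZ k a : pcl (k *: a)%X = k *: pcl a.
Proof. exact: pcl_scale. Qed.
Lemma pclN a : pcl (EOpp a) = - pcl a.
Proof. exact: pcl_opp. Qed.
Lemma pcl0 : pcl 0%X = 0.
Proof. by []. Qed.

Lemma pmulA : associative pmul.
Proof.
move=> x y z.
have [[[a ->] [b ->]] [c ->]] := (pcl_surj x, pcl_surj y, pcl_surj z).
by rewrite -!pcl_mul; apply/pclP/pc_mulA.
Qed.
Lemma pmulDl : left_distributive pmul +%R.
Proof.
move=> x y z.
have [[[a ->] [b ->]] [c ->]] := (pcl_surj x, pcl_surj y, pcl_surj z).
by rewrite -pclD -!pcl_mul -pclD; apply/pclP/pc_mulDl.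
Qed.
Lemma pmulDr : right_distributive pmul +%R.
Proof.
move=> x y z.
have [[[a ->] [b ->]] [c ->]] := (pcl_surj x, pcl_surj y, pcl_surj z).
by rewrite -pclD -!pcl_mul -pclD; apply/pclP/pc_mulDr.
Qed.
Lemma pscaleAl k x y : pmul (k *: x) y = k *: pmul x y.
Proof.
have [[a ->] [b ->]] := (pcl_surj x, pcl_surj y).
by rewrite -pclZ -!pcl_mul -pclZ; apply/pclP/pc_scaleAl.
Qed.
Lemma pscaleAr k x y : pmul x (k *: y) = k *: pmul x y.
Proof.
have [[a ->] [b ->]] := (pcl_surj x, pcl_surj y).
by rewrite -pclZ -!pcl_mul -pclZ; apply/pclP/pc_scaleAr.
Qed.
Lemma pmul1l h x : pmul (pone h) x = x.
Proof. by have [a ->] := pcl_surj x; rewrite -pcl_mul; apply/pclP/pc_mul1l. Qed.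
Lemma pmul1r h x : pmul x (pone h) = x.
Proof. by have [a ->] := pcl_surj x; rewrite -pcl_mul; apply/pclP/pc_mul1r. Qed.

(* [ehomog d e]: every term of [e] has degree [d]; the classes of such        *)
(* expressions form the degree d component of the graded algebra [palg P].    *)
Inductive ehomog : nat -> E -> Prop :=
| eh_gen g : ehomog (pdeg g) (EGen g)
| eh_zero d : ehomog d 0%X
| eh_one h : ehomog 0 (EOne h)
| eh_opp d a : ehomog d a -> ehomog d (EOpp a)
| eh_add d a b : ehomog d a -> ehomog d b -> ehomog d (a + b)%X
| eh_scale d k a : ehomog d a -> ehomog d (k *: a)%X
| eh_mul c d a b : ehomog c a -> ehomog d b -> ehomog (c + d) (a * b)%X.

End PresentedAlgebra.

Record gspace (K : fieldType) := GSpace {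
  gs_car :> lmodType K;
  gcomp : nat -> gs_car -> Prop;
  gcomp0 : forall d, gcomp d 0;
  gcompP : forall d (c : K) (v w : gs_car),
    gcomp d v -> gcomp d w -> gcomp d (c *: v + w);
  gcomp_sum : forall v : gs_car, exists N (w : nat -> gs_car),
    (forall d, gcomp d (w d)) /\ v = \sum_(d < N) w d;
  gcomp_direct : forall N (w : nat -> gs_car),
    (forall d, gcomp d (w d)) -> \sum_(d < N) w d = 0 ->
    forall d, (d < N)%N -> w d = 0 }.

Record gaction (K : fieldType) (P : presentation K) (V : gspace K) := GAction {
  ga_act :> palg P -> V -> V;
  ga_linl : forall v (c : K) a b,
    ga_act (c *: a + b) v = c *: ga_act a v + ga_act b v;
  ga_linr : forall a (c : K) v w,
    ga_act a (c *: v + w) = c *: ga_act a v + ga_act a w;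
  ga_mul : forall a b v, ga_act (pmul a b) v = ga_act a (ga_act b v);
  ga_one : forall (h : punital P) v, ga_act (pone h) v = v;
  ga_deg : forall c (e : expr K (punital P) (pgen P)) d v,
    ehomog c e -> gcomp d v -> gcomp (c + d) (ga_act (pcl e) v) }.

Lemma ga_act0 (K : fieldType) (P : presentation K) (V : gspace K)
  (A : gaction P V) a : ga_act A a 0 = 0.
Proof. by have := ga_linr A a (-1) 0 0; rewrite scaler0 addr0 scaleN1r addNr. Qed.

Record gmod (K : fieldType) (P : presentation K) := GMod {
  gm_space :> gspace K;
  gm_act : gaction P gm_space }.

Record gmod_hom (K : fieldType) (P : presentation K) (M N : gmod P) := GModHom {
  gmh_fun :> {linear M -> N};
  gmh_deg : forall d v, gcomp d v -> gcomp d (gmh_fun v);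
  gmh_act : forall a v, gmh_fun (gm_act M a v) = gm_act N a (gmh_fun v) }.

Record category := Category {
  obj :> Type;
  hom : obj -> obj -> Type;
  heq : forall a b, hom a b -> hom a b -> Prop;
  hid : forall a, hom a a;
  hcomp : forall a b c, hom b c -> hom a b -> hom a c;
  heq_refl : forall a b (f : hom a b), heq f f;
  heq_sym : forall a b (f g : hom a b), heq f g -> heq g f;
  heq_trans : forall a b (f g h : hom a b), heq f g -> heq g h -> heq f h;
  hcomp_heq : forall a b c (g g' : hom b c) (f f' : hom a b),
    heq g g' -> heq f f' -> heq (hcomp g f) (hcomp g' f');
  hcomp1l : forall a b (f : hom a b), heq (hcomp (hid b) f) f;
  hcomp1r : forall a b (f : hom a b), heq (hcomp f (hid a)) f;
  hcompA : forall a b c d (h : hom c d) (g : hom b c) (f : hom a b),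
    heq (hcomp h (hcomp g f)) (hcomp (hcomp h g) f) }.

Record is_functor (A B : category) (F : A -> B)
    (Fh : forall a b : A, hom a b -> hom (F a) (F b)) : Prop := IsFunctor {
  functor_heq : forall (a b : A) (f g : hom a b),
    heq f g -> heq (Fh a b f) (Fh a b g);
  functor_id : forall a : A, heq (Fh a a (hid a)) (hid (F a));
  functor_comp : forall (a b c : A) (g : hom b c) (f : hom a b),
    heq (Fh a c (hcomp g f)) (hcomp (Fh b c g) (Fh a b f)) }.

Section GModCategory.
Variables (K : fieldType) (P : presentation K).
Implicit Types M N : gmod P.

Program Definition gmod_id M : gmod_hom M M := @GModHom K P M M idfun _ _.

Program Definition gmod_comp M N L (g : gmod_hom N L) (f : gmod_hom M N) :
  gmod_hom M L := @GModHom K P M L (g \o f : {linear M -> L}) _ _.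
Next Obligation. by do 2 apply: gmh_deg. Qed.
Next Obligation. by rewrite !gmh_act. Qed.

Program Definition gmod_category : category :=
  @Category (gmod P) (@gmod_hom K P) (fun M N f g => f =1 g)
    gmod_id gmod_comp _ _ _ _ _ _ _.
Next Obligation. by move=> v; rewrite H. Qed.
Next Obligation. by move=> v; rewrite H H0. Qed.
Next Obligation. by move=> v /=; rewrite H0 H. Qed.
End GModCategory.

Definition eprod (K G : Type) (f : nat -> expr K true G) (s : seq nat) : expr K true G :=
  foldr (fun i e => (f i * e)%X) 1%X s.

Inductive dgen (n : nat) : Type :=
| DT of {i : nat | (0 < i < n)%N}
| DX of {i : nat | (0 < i <= n)%N}
| DY of {i : nat | (0 < i <= n)%N}.

Section DAHA.
Variables (K : fieldType) (q t : K) (n : nat).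
Local Notation E := (expr K true (dgen n)).

(* The expressions below are 0 outside of the range of the index [i].         *)
Definition eT (i : nat) : E :=
  if insub i is Some j then EGen (DT j) else 0%X.
Definition eX (i : nat) : E :=
  if insub i is Some j then EGen (DX j) else 0%X.
Definition eY (i : nat) : E :=
  if insub i is Some j then EGen (DY j) else 0%X.

(* The inverse of T_i, by the quadratic relation (see [eTVP] below).          *)
Definition eTV (i : nat) : E := (q^-1 *: (eT i + (q - 1)%R *: 1))%X.

Definition eXs (k : nat) : E := eprod eX (iota 1 k).

Definition epi : E := ((q ^- n)%R *: (eY 1 * eprod eT (iota 1 n.-1)))%X.

(* [dr_piX] is [dr_YXs] with the common left factor X_2 ... X_n cancelled; it *)
(* is a consequence of the other relations in the double affine Hecke         *)
(* algebra, where the X_i are invertible, but it has to be imposed in the     *)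
(* presentation of the positive part, where they are not.                     *)
Inductive drel : E -> E -> Prop :=
| dr_quad i of (0 < i < n)%N : drel ((eT i - 1) * (eT i + q *: 1)) 0
| dr_braid i of (0 < i)%N & (i.+1 < n)%N :
    drel (eT i * eT i.+1 * eT i) (eT i.+1 * eT i * eT i.+1)
| dr_TT i j of (0 < i < n)%N & (0 < j < n)%N & (i.+1 < j)%N || (j.+1 < i)%N :
    drel (eT i * eT j) (eT j * eT i)
| dr_TXT i of (0 < i < n)%N : drel (eTV i * eX i * eTV i) (q^-1 *: eX i.+1)
| dr_TX i j of (0 < i < n)%N & (0 < j <= n)%N & (j != i) & (j != i.+1) :
    drel (eT i * eX j) (eX j * eT i)
| dr_XX i j of (0 < i <= n)%N & (0 < j <= n)%N :
    drel (eX i * eX j) (eX j * eX i)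
| dr_TYT i of (0 < i < n)%N : drel (eT i * eY i * eT i) (q *: eY i.+1)
| dr_TY i j of (0 < i < n)%N & (0 < j <= n)%N & (j != i) & (j != i.+1) :
    drel (eT i * eY j) (eY j * eT i)
| dr_YY i j of (0 < i <= n)%N & (0 < j <= n)%N :
    drel (eY i * eY j) (eY j * eY i)
| dr_YTX of (1 < n)%N : drel (eY 1 * eT 1 * eX 1) (eX 2 * eY 1 * eT 1)
| dr_YXs : drel (eY 1 * eXs n) (t *: (eXs n * eY 1))
| dr_piX : drel (epi * eX n) (t *: (eX 1 * epi)).

Definition ddeg (g : dgen n) : nat := if g is DX _ then 1%N else 0%N.

Definition DAHA : presentation K := @Presentation K true (dgen n) ddeg drel.

Definition dcl (e : E) : palg DAHA := @pcl K DAHA e.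

Lemma eTVP i : q != 0 -> (0 < i < n)%N ->
  pmul (dcl (eT i)) (dcl (eTV i)) = @pone K DAHA isT /\
  pmul (dcl (eTV i)) (dcl (eT i)) = @pone K DAHA isT.
Proof.
move=> q0 hi.
have : dcl ((eT i - 1) * (eT i + q *: 1))%X = 0.
  by apply/pclP/pc_rel; apply: dr_quad.
rewrite /eTV /dcl !(pcl_mul, pclD, pclN, pclZ).
move: (@pcl K DAHA (eT i)) => T.
rewrite !(pmulDl, pmulDr, pscaleAl, pscaleAr) -?scaleN1r.
rewrite !(pmulDl, pmulDr, pscaleAl, pscaleAr) -/(@pone K DAHA isT).
rewrite !(@pmul1l K DAHA, @pmul1r K DAHA).
rewrite !scaleN1r scalerN addrA => /eqP.
rewrite subr_eq0 -addrA => /eqP h.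
by rewrite scalerBl scale1r h scalerA mulVf // scale1r.
Qed.

(* MathComp multiplies permutations from left to right, hence the [rev]:      *)
(* [wperm [:: i_1; ...; i_r]] is the composite s_(i_1) o ... o s_(i_r).       *)
Definition sadj (i : nat) : 'S_n :=
  if (insub i.-1 : option 'I_n, insub i : option 'I_n) is (Some a, Some b)
  then tperm a b else 1%g.
Definition wperm (w : seq nat) : 'S_n := (\prod_(i <- rev w) sadj i)%g.
Definition word_ok (w : seq nat) : bool := all (fun i => 0 < i < n)%N w.
Definition reduced_word (s : 'S_n) (w : seq nat) : Prop :=
  [/\ word_ok w, wperm w = s
    & forall w', word_ok w' -> wperm w' = s -> (size w <= size w')%N].
Definition redword (s : 'S_n) : seq nat := xget [::] (reduced_word s).
Definition plength (s : 'S_n) : nat := size (redword s).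
Definition eTs (s : 'S_n) : E := eprod eT (redword s).

Definition young (k : nat) (s : 'S_n) : bool :=
  [forall i : 'I_n, (i < k)%N ==> (s i == i)].

Definition qfact (m : nat) : K := \prod_(1 <= i < m.+1) ((1 - q ^+ i) / (1 - q)).

Definition deps (k : nat) : palg DAHA :=
  (qfact (n - k))^-1 *:
    \sum_(s : 'S_n | young k s)
      (q ^+ 'C(n - k, 2) / q ^+ plength s) *: dcl (eTs s).

Definition dact (V : gmod DAHA) (e : E) (v : V) : V := gm_act V (dcl e) v.

Definition Lspace (V : gmod DAHA) (k : nat) (v : V) : Prop :=
  exists u : V, v = gm_act V (pmul (dcl (eXs k)) (deps k)) u.

End DAHA.
Arguments Lspace {K q t n} V k v.

Inductive bgen : Type :=
| Be of nat
| BT (k : nat) of {i : nat | (0 < i < k)%N}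
| Bz (k : nat) of {i : nat | (0 < i <= k)%N}
| Bdp of nat                                           (* d_+ : k   -> k+1 *)
| Bdm of nat.                                          (* d_- : k+1 -> k   *)

Section Bqt.
Variables (K : fieldType) (q t : K).
Local Notation E := (expr K false bgen).

(* In all expressions below the first index is the source vertex.             *)
Definition be (k : nat) : E := EGen (Be k).
Definition bT (k i : nat) : E :=
  if insub i is Some j then EGen (@BT k j) else 0%X.
Definition bz (k i : nat) : E :=
  if insub i is Some j then EGen (@Bz k j) else 0%X.
Definition bdp (k : nat) : E := EGen (Bdp k).
Definition bdm (k : nat) : E := if k is k'.+1 then EGen (Bdm k') else 0%X.

Definition bTV (k i : nat) : E := (q^-1 *: (bT k i + (q - 1)%R *: be k))%X.

Definition bphi (k : nat) : E :=
  ((q - 1)^-1 *: (bdp k.-1 * bdm k - bdm k.+1 * bdp k))%X.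

Inductive brel : E -> E -> Prop :=
| br_ee k : brel (be k * be k) (be k)
| br_ee0 j k of j != k : brel (be j * be k) 0
| br_eT k i of (0 < i < k)%N : brel (be k * bT k i) (bT k i)
| br_Te k i of (0 < i < k)%N : brel (bT k i * be k) (bT k i)
| br_ez k i of (0 < i <= k)%N : brel (be k * bz k i) (bz k i)
| br_ze k i of (0 < i <= k)%N : brel (bz k i * be k) (bz k i)
| br_edp k : brel (be k.+1 * bdp k) (bdp k)
| br_dpe k : brel (bdp k * be k) (bdp k)
| br_edm k of (0 < k)%N : brel (be k.-1 * bdm k) (bdm k)
| br_dme k of (0 < k)%N : brel (bdm k * be k) (bdm k)
| br_quad k i of (0 < i < k)%N :
    brel ((bT k i - be k) * (bT k i + q *: be k)) 0
| br_braid k i of (0 < i)%N & (i.+1 < k)%N :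
    brel (bT k i * bT k i.+1 * bT k i) (bT k i.+1 * bT k i * bT k i.+1)
| br_TT k i j of (0 < i < k)%N & (0 < j < k)%N & (i.+1 < j)%N || (j.+1 < i)%N :
    brel (bT k i * bT k j) (bT k j * bT k i)
| br_TzT k i of (0 < i < k)%N :
    brel (bTV k i * bz k i.+1 * bTV k i) (q^-1 *: bz k i)
| br_zT k i j of (0 < i <= k)%N & (0 < j < k)%N & (i != j) & (i != j.+1) :
    brel (bz k i * bT k j) (bT k j * bz k i)
| br_zz k i j of (0 < i <= k)%N & (0 < j <= k)%N :
    brel (bz k i * bz k j) (bz k j * bz k i)
| br_dmdmT k of (1 < k)%N :
    brel (bdm k.-1 * bdm k * bT k k.-1) (bdm k.-1 * bdm k)
| br_dmT k i of (0 < i)%N & (i.+1 < k)%N :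
    brel (bdm k * bT k i) (bT k.-1 i * bdm k)
| br_Tdpdp k : brel (bT k.+2 1 * bdp k.+1 * bdp k) (bdp k.+1 * bdp k)
| br_dpT k i of (0 < i < k)%N : brel (bdp k * bT k i) (bT k.+1 i.+1 * bdp k)
| br_phidm k of (1 < k)%N :
    brel (q *: (bphi k.-1 * bdm k)) (bdm k * bphi k * bT k k.-1)
| br_phidp k of (0 < k)%N :
    brel (bT k.+1 1 * bphi k.+1 * bdp k) (q *: (bdp k * bphi k))
| br_zdm k i of (0 < i < k)%N : brel (bz k.-1 i * bdm k) (bdm k * bz k i)
| br_dpz k i of (0 < i <= k)%N : brel (bdp k * bz k i) (bz k.+1 i.+1 * bdp k)
| br_z1zk k of (0 < k)%N :
    brel (bz k 1 * (q *: (bdp k.-1 * bdm k) - bdm k.+1 * bdp k))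
      ((q * t)%R *: ((bdp k.-1 * bdm k - bdm k.+1 * bdp k) * bz k k)).

Definition bdeg (g : bgen) : nat := if g is Bdp _ then 1%N else 0%N.

Definition Bqt : presentation K := @Presentation K false bgen bdeg brel.

(* The expressions representing the elements of the subalgebra B^(N): they    *)
(* only involve generators between the idempotents e_0, ..., e_N.             *)
Definition bgen_upto (N : nat) (g : bgen) : bool :=
  match g with
  | Be k | BT k _ | Bz k _ => (k <= N)%N
  | Bdp k | Bdm k => (k < N)%N
  end.

Fixpoint bexpr_upto (N : nat) (r : E) : bool :=
  match r with
  | EGen g => bgen_upto N g
  | EZero => true
  | EOne _ => false
  | EOpp a => bexpr_upto N a
  | EScale _ a => bexpr_upto N a
  | EAdd a b | EMul a b => bexpr_upto N a && bexpr_upto N b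
  end.

(* The action of B^(n) on L_0(V) + ... + L_n(V); [y k] is the component of    *)
(* [y] in L_k(V).                                                             *)
Section Lact.
Variables (n : nat) (V : gmod (DAHA q t n)).

Definition Ldp (k : nat) (v : V) : V :=
  q ^+ k *: dact (eX K n 1 * eprod (eTV q n) (iota 1 k))%X v.

Definition Ldm (k : nat) (v : V) : V :=
  (q - 1) *: \sum_(k <= j < n.+1)
    q ^+ (j - k) *: dact (eprod (eTV q n) (rev (iota k (j - k)))) v.

Definition single (k : nat) (v : V) : nat -> V :=
  fun j => if j == k then v else 0.

Definition Lgen (g : bgen) (y : nat -> V) : nat -> V :=
  match g with
  | Be k => single k (y k)
  | BT k i => single k (dact (eT K n (val i)) (y k))
  | Bz k i => single k ((q * t)^-1 *: dact (eY K n (val i)) (y k))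
  | Bdp k => single k.+1 (Ldp k (y k))
  | Bdm k => single k (Ldm k.+1 (y k.+1))
  end.

Fixpoint Lact (r : E) (y : nat -> V) : nat -> V :=
  match r with
  | EGen g => Lgen g y
  | EZero => fun _ => 0
  | EOne _ => y
  | EOpp a => fun k => - Lact a y k
  | EAdd a b => fun k => Lact a y k + Lact b y k
  | EScale c a => fun k => c *: Lact a y k
  | EMul a b => Lact a (Lact b y)
  end.
End Lact.

End Bqt.

Section CompatibleSequences.
Variables (K : fieldType) (q t : K).

(* The modules and maps of index n < [cs_start] are irrelevant.               *)
Record compseq := CompSeq {
  cs_start : nat;
  cs_mod :> forall n, gmod (DAHA q t n);
  cs_map : forall n, {linear cs_mod n.+1 -> cs_mod n};
  cs_start_gt0 : (0 < cs_start)%N;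
  cs_map_deg : forall n, (cs_start <= n)%N -> forall d v,
    gcomp d v -> gcomp d (cs_map n v);
  cs_mapT : forall n, (cs_start <= n)%N -> forall i v, (0 < i < n)%N ->
    cs_map n (dact (eT K n.+1 i) v) = dact (eT K n i) (cs_map n v);
  cs_mapX : forall n, (cs_start <= n)%N -> forall i v, (0 < i <= n)%N ->
    cs_map n (dact (eX K n.+1 i) v) = dact (eX K n i) (cs_map n v);
  cs_mapX0 : forall n, (cs_start <= n)%N -> forall v,
    cs_map n (dact (eX K n.+1 n.+1) v) = 0;
  cs_map_pi : forall n, (cs_start <= n)%N -> forall v,
    cs_map n (dact (epi q n.+1 * eT K n.+1 n)%X v) =
    dact (epi q n) (cs_map n v) }.

(* Families (phi^(n)) are allowed to be defined for n >= [csh_start] only,    *)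
(* where [csh_start] >= max(n_1, n_2), and are considered up to equality for  *)
(* n large.  The families with [csh_start] = max(n_1, n_2) are not closed     *)
(* under composition: a composite through a sequence starting at n_2 is only  *)
(* defined for n >= n_2, even when its source and target start earlier.       *)
Record cs_hom (C D : compseq) := CSHom {
  csh_start : nat;
  csh_fun :> forall n, {linear C n -> D n};
  csh_startP : (maxn (cs_start C) (cs_start D) <= csh_start)%N;
  csh_deg : forall n, (csh_start <= n)%N -> forall d v,
    gcomp d v -> gcomp d (csh_fun n v);
  csh_act : forall n, (csh_start <= n)%N -> forall a v,
    csh_fun n (gm_act (C n) a v) = gm_act (D n) a (csh_fun n v);
  csh_map : forall n, (csh_start <= n)%N -> forall v,
    csh_fun n (cs_map C n v) = cs_map D n (csh_fun n.+1 v) }.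

Definition cs_heq (C D : compseq) (f g : cs_hom C D) : Prop :=
  exists N, forall n, (N <= n)%N -> f n =1 g n.

Program Definition cs_id (C : compseq) : cs_hom C C :=
  @CSHom C C (cs_start C) (fun n => idfun) _ _ _ _.
Next Obligation. by rewrite maxnn. Qed.

Program Definition cs_comp (C D F : compseq) (g : cs_hom D F) (f : cs_hom C D) :
    cs_hom C F :=
  @CSHom C F (maxn (csh_start f) (csh_start g))
    (fun n => g n \o f n : {linear C n -> F n}) _ _ _ _.
Next Obligation.
have := csh_startP f; have := csh_startP g; rewrite !geq_max.
by move=> /andP[_ h1] /andP[h2 _]; rewrite !leq_max h1 h2 orbT.
Qed.
Next Obligation.
by move: H; rewrite geq_max => /andP[hf hg]; do 2 apply: csh_deg => //.
Qed.
Next Obligation.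
by move: H; rewrite geq_max => /andP[hf hg]; rewrite !csh_act.
Qed.
Next Obligation.
by move: H; rewrite geq_max => /andP[hf hg]; rewrite !csh_map.
Qed.

Program Definition cs_category : category :=
  @Category compseq cs_hom cs_heq cs_id cs_comp _ _ _ _ _ _ _.
Next Obligation. by exists 0%N. Qed.
Next Obligation. by case: H => N h; exists N => n hn v; rewrite h. Qed.
Next Obligation.
case: H H0 => N1 h1 [N2 h2]; exists (maxn N1 N2) => n.
by rewrite geq_max => /andP[? ?] v; rewrite h1 // h2.
Qed.
Next Obligation.
case: H H0 => N1 h1 [N2 h2]; exists (maxn N1 N2) => n.
by rewrite geq_max => /andP[? ?] v /=; rewrite h2 // h1.
Qed.
Next Obligation. by exists 0%N. Qed.
Next Obligation. by exists 0%N. Qed.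
Next Obligation. by exists 0%N. Qed.

End CompatibleSequences.

Section DProd.
Variables (K : fieldType) (I : Type) (V : I -> lmodType K).
Definition dprod := forall i, V i.
HB.instance Definition _ := Choice.copy dprod (forall i, V i).
Let z : dprod := fun i => 0.
Let o (f : dprod) : dprod := fun i => - f i.
Let a (f g : dprod) : dprod := fun i => f i + g i.
Let s (c : K) (f : dprod) : dprod := fun i => c *: f i.
Let aA : associative a.
Proof. by move=> f g h; apply: functional_extensionality_dep => i; exact: addrA. Qed.
Let aC : commutative a.
Proof. by move=> f g; apply: functional_extensionality_dep => i; exact: addrC. Qed.
Let a0 : left_id z a.
Proof. by move=> f; apply: functional_extensionality_dep => i; exact: add0r. Qed.
Let aN : left_inverse z o a.
Proof. by move=> f; apply: functional_extensionality_dep => i; exact: addNr. Qed.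
HB.instance Definition _ := GRing.isZmodule.Build dprod aA aC a0 aN.
Let sA c d f : s c (s d f) = s (c * d) f.
Proof. by apply: functional_extensionality_dep => i; exact: scalerA. Qed.
Let s1 : left_id 1 s.
Proof. by move=> f; apply: functional_extensionality_dep => i; exact: scale1r. Qed.
Let sDr : right_distributive s +%R.
Proof. by move=> c f g; apply: functional_extensionality_dep => i; exact: scalerDr. Qed.
Let sDl f : {morph s^~ f : c d / c + d}.
Proof. by move=> c d; apply: functional_extensionality_dep => i; exact: scalerDl. Qed.
HB.instance Definition _ := GRing.Zmodule_isLmodule.Build K dprod sA s1 sDr sDl.

Lemma dprodDE (f g : dprod) i : (f + g) i = f i + g i. Proof. by []. Qed.
Lemma dprodZE (c : K) (f : dprod) i : (c *: f) i = c *: f i. Proof. by []. Qed.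
Lemma dprod0E i : (0 : dprod) i = 0. Proof. by []. Qed.
Lemma dprod_sumE (J : Type) (r : seq J) (P : pred J) (F : J -> dprod) i :
  (\sum_(j <- r | P j) F j) i = \sum_(j <- r | P j) F j i.
Proof. by elim/big_rec2: _ => //= j y1 y2 _ <-. Qed.
End DProd.

Section StableLimit.
Variables (K : fieldType) (q t : K) (C : compseq q t).

(* A sequence indexed by n >= max(n_1, k) is extended by 0 to smaller n.      *)
Definition cs_seq : lmodType K := dprod (fun n => C n : lmodType K).
Definition cs_seqs : lmodType K := dprod (fun _ : nat => cs_seq).

Definition stable_seq (k d : nat) (v : cs_seq) : Prop :=
  [/\ forall n, (n < maxn (cs_start C) k)%N -> v n = 0,
      forall n, (maxn (cs_start C) k <= n)%N -> Lspace (C n) k (v n),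
      forall n, (maxn (cs_start C) k <= n)%N -> gcomp d (v n)
    & forall n, (maxn (cs_start C) k <= n)%N -> cs_map C n (v n.+1) = v n].

(* frakL_k(C), the sum over d of the spaces of stable sequences of degree d   *)
Definition frakLk (k : nat) (v : cs_seq) : Prop :=
  exists N (w : nat -> cs_seq),
    (forall d, stable_seq k d (w d)) /\ v = \sum_(d < N) w d.

(* frakL(C), the direct sum of the frakL_k(C); the component in frakL_k(C) of *)
(* [x : frakL] is [frakL_val x k].                                            *)
Definition frakL_pred (x : cs_seqs) : Prop :=
  (forall k, frakLk k (x k)) /\ exists N, forall k, (N <= k)%N -> x k = 0.

Lemma stable_seq0 k d : stable_seq k d 0.
Proof.
split=> n hn //.
- by exists 0; rewrite ga_act0.
- exact: gcomp0.
- by rewrite dprod0E linear0.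
Qed.

Lemma stable_seqP k d (c : K) v w :
  stable_seq k d v -> stable_seq k d w -> stable_seq k d (c *: v + w).
Proof.
move=> [v0 vL vd vs] [w0 wL wd ws]; split=> n hn.
- by rewrite dprodDE dprodZE v0 // w0 // scaler0 addr0.
- have [[a ea] [b eb]] := (vL n hn, wL n hn).
  by exists (c *: a + b); rewrite ga_linr -ea -eb.
- by apply: gcompP; [apply: vd | apply: wd].
- by rewrite !dprodDE !dprodZE linearP vs // ws.
Qed.

Lemma frakLk0 k : frakLk k 0.
Proof.
by exists 0%N, (fun=> 0); split=> [d|]; [exact: stable_seq0 | rewrite big_ord0].
Qed.

Lemma frakLk_pad k v : frakLk k v -> exists N (w : nat -> cs_seq),
  [/\ forall d, stable_seq k d (w d), forall d, (N <= d)%N -> w d = 0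
    & forall M, (N <= M)%N -> v = \sum_(d < M) w d].
Proof.
case=> N [w [hw ->]]; exists N, (fun d => if (d < N)%N then w d else 0).
split=> [d|d|M NM]; first by case: ifP => _ //; exact: stable_seq0.
  by rewrite leqNgt => /negbTE ->.
by rewrite (big_ord_widen M w NM) big_mkcond.
Qed.

Lemma frakLkP k (c : K) v w : frakLk k v -> frakLk k w -> frakLk k (c *: v + w).
Proof.
move=> /frakLk_pad [N1 [a [ha _ ea]]] /frakLk_pad [N2 [b [hb _ eb]]].
exists (maxn N1 N2), (fun d => c *: a d + b d); split=> [d|].
  exact: stable_seqP.
rewrite (ea _ (leq_maxl N1 N2)) (eb _ (leq_maxr N1 N2)).
by rewrite scaler_sumr -big_split.
Qed.

Definition frakLb : pred cs_seqs := fun x => `[< frakL_pred x >].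

Record frakL_car : Type := FrakL {
  frakL_val : cs_seqs;
  frakL_valP : frakLb frakL_val }.

HB.instance Definition _ := [isSub of frakL_car for frakL_val].
HB.instance Definition _ := [Choice of frakL_car by <:].

Fact frakL_submod : submod_closed frakLb.
Proof.
split=> [|c x y /asboolP [hx [M xM]] /asboolP [hy [N yN]]]; apply/asboolP.
  by split=> [k|]; [exact: frakLk0 | exists 0%N].
split=> [k|]; first exact: frakLkP.
exists (maxn M N) => k; rewrite geq_max => /andP[hM hN].
by rewrite dprodDE dprodZE xM // yN // scaler0 addr0.
Qed.
HB.instance Definition _ := GRing.isSubmodClosed.Build K cs_seqs frakLb frakL_submod.
HB.instance Definition _ := [SubChoice_isSubLmodule of frakL_car by <:].

Lemma frakL_val0 : frakL_val 0 = 0.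
Proof. exact: (raddf0 (\val : frakL_car -> cs_seqs)). Qed.
Lemma frakL_valDZ c (x y : frakL_car) :
  frakL_val (c *: x + y) = c *: frakL_val x + frakL_val y.
Proof. exact: (linearP (\val : frakL_car -> cs_seqs)). Qed.
Lemma frakL_val_sum N (w : nat -> frakL_car) :
  frakL_val (\sum_(d < N) w d) = \sum_(d < N) frakL_val (w d).
Proof. exact: (raddf_sum (\val : frakL_car -> cs_seqs)). Qed.

Definition frakL_deg (d : nat) (x : frakL_car) : Prop :=
  forall k, stable_seq k d (frakL_val x k).

Fact frakL_deg0 d : frakL_deg d 0.
Proof. by move=> k; rewrite frakL_val0; exact: stable_seq0. Qed.

Fact frakL_degP d (c : K) (x y : frakL_car) :
  frakL_deg d x -> frakL_deg d y -> frakL_deg d (c *: x + y).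
Proof. by move=> hx hy k; rewrite frakL_valDZ; exact: stable_seqP. Qed.

Fact frakL_deg_sum (x : frakL_car) : exists N (w : nat -> frakL_car),
  (forall d, frakL_deg d (w d)) /\ x = \sum_(d < N) w d.
Proof.
have /asboolP [hx [M xM]] := frakL_valP x.
have /choice [N hN] : forall k, exists N, exists w : nat -> cs_seq,
    [/\ forall d, stable_seq k d (w d), forall d, (N <= d)%N -> w d = 0,
        forall L, (N <= L)%N -> frakL_val x k = \sum_(d < L) w d
      & (M <= k)%N -> forall d, w d = 0].
  move=> k; case: (leqP M k) => hk.
    exists 0%N, (fun=> 0); split=> // [d|L _]; first exact: stable_seq0.
    by rewrite xM // big1.
  by have [N [w [h1 h2 h3]]] := frakLk_pad (hx k); exists N, w.
have /choice [w hw] := hN.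
have pw d : frakLb (fun k => w k d).
  apply/asboolP; split=> [k|].
    exists d.+1, (fun e => if e == d then w k d else 0).
    split=> [e|]; first by case: eqP => [->|_]; [case: (hw k) | exact: stable_seq0].
    by rewrite -big_mkcond /= (big_pred1 (ord_max : 'I_d.+1)).
  by exists M => k hk; case: (hw k) => _ _ _ ->.
exists (\max_(k < M) N k), (fun d => FrakL (pw d)); split=> [d k|].
  by case: (hw k).
apply: val_inj; apply: etrans (esym (frakL_val_sum _ (fun d => FrakL (pw d)))).
apply: functional_extensionality_dep => k.
rewrite dprod_sumE /=; case: (leqP M k) => hk.
  by rewrite xM // big1 // => d _; case: (hw k) => _ _ _ ->.
by case: (hw k) => _ _ h _; apply: h; apply: (leq_bigmax (Ordinal hk)).
Qed.

Fact frakL_direct N (w : nat -> frakL_car) :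
  (forall d, frakL_deg d (w d)) -> \sum_(d < N) w d = 0 ->
  forall d, (d < N)%N -> w d = 0.
Proof.
move=> hw /(congr1 frakL_val); rewrite frakL_val_sum frakL_val0 => e d hd.
apply: val_inj; rewrite [RHS]frakL_val0.
apply: functional_extensionality_dep => k; apply: functional_extensionality_dep => n.
case: (ltnP n (maxn (cs_start C) k)) => hn.
  by have [h _ _ _] := hw d k; exact: h.
apply: (@gcomp_direct _ (C n) N (fun d => frakL_val (w d) k n)) hd => [d'|].
  by case: (hw d' k) => _ _ + _; apply.
by have := congr1 (fun f : cs_seqs => f k n) e; rewrite !dprod_sumE.
Qed.

Definition frakL : gspace K :=
  GSpace frakL_deg0 frakL_degP frakL_deg_sum frakL_direct.

(* The B_(q,t)-action on frakL(C) is the stable limit of the actions on the   *)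
(* L(V^(n)): for r in B^(N) the entries of index n >= N of r x are given by   *)
(* the action of r on the entries of index n of x.  The remaining entries are *)
(* images of those under the maps of [C], since r x is in [frakL].            *)
Definition stable_limit_action (A : gaction (Bqt q t) frakL) : Prop :=
  forall N (r : expr K false bgen) (x : frakL) n k,
    bexpr_upto N r -> (N <= n)%N -> (cs_start C <= n)%N ->
    frakL_val (ga_act A (@pcl K (Bqt q t) r) x) k n =
    Lact r (fun j => frakL_val x j n) k.

End StableLimit.

(* Q(q,t), as the field of fractions of Q[q][t] *)
Definition Qqt : fieldType := {fraction {poly {poly rat}}}.
Definition Qq : Qqt := tofrac ('X%:P).
Definition Qt : Qqt := tofrac 'X.

(* Main.v *)
(* L_k(V) consists of the vectors X_1 ... X_k u with T_j u = u for j > k: by  *)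
(* Matsumoto's theorem the T_sigma depend on sigma only, hence epsilon_k maps *)
(* into the vectors fixed by these T_j, on which it acts as a scalar, nonzero *)
(* because q is transcendental.  Two computations then carry the argument.    *)
(* On L_(k+1)(V) the operator phi is q^k X_1 T_1^-1 ... T_k^-1, which reduces *)
(* the relations involving phi to braid relations.  For u fixed by the T_j    *)
(* with j > k,                                                                *)
(*   Y_1 X_1 ... X_k u                                                        *)
(*     = t q^k X_1 ... X_k pi T_(n-1) ... T_k T_(k-1)^-1 ... T_1^-1 u,        *)
(* which gives the stability of L_k(V) under the z_i, the relation with z_1   *)
(* and z_k, and the compatibility of the z_i with the maps Pi.                *)
(*   A stable sequence is determined by its entries of large index and, since *)
(* the Pi preserve the L_k, any tail of one extends downwards.  So generators *)
(* and homomorphisms can be made to act on entries of large index, where all  *)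
(* identities hold already in L(V^(n)).                                       *)

From HB Require Import structures.
From mathcomp Require Import all_boot all_order all_fingroup all_algebra.
From mathcomp Require Import boolp zify ssrAC ring.
Require Import Defs.

Set Implicit Arguments.
Unset Strict Implicit.
Unset Printing Implicit Defensive.

Import GRing.Theory.
Local Open Scope ring_scope.

(** * Reduced words of permutations *)

(** Functoriality is formal once the limit is known to be a module, so the weight lies on the
    action. Each generator of B acts on L(V^(n)) by an explicit formula, and for finite n three
    facts are needed: the formulas preserve the spaces L_k ([Lgen_Lspace]), they satisfy the
    relations of B^(n) ([Lact_rel]), and they commute with Pi ([map_Lgen]).

    All three rest on [LspaceP], which replaces epsilon_k by invariance under the T_j with j > k.
    Most relations are then commutations of braid words; the substantial ones are [Isum_Isum_T] for
    d_-^2, [phi_Ldp] for phi, and [Y1_Ldp] for z_1 and z_k, which uses [Y1_Xs] and [Tdown_Isum]. In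
    passing from n to n + 1, d_- gains one summand, which on L_k carries a factor X_(n+1) killed by
    Pi, and the formula for Y_1 gains a letter T_n next to pi, which is what the condition on pi and
    Pi absorbs.

    An expression in the generators visits finitely many vertices, so it acts on all entries of
    large index; by [frakL_ext] these determine an element of the limit, and by [extend_stable] they
    can be prescribed. The relations of B and the functor laws are therefore checked on such
    entries. A homomorphism commutes with all of D_n^+, hence with the formulas ([csh_Lact]). *)

Section Length.
Variable n : nat.
Implicit Types (s : 'S_n) (w : seq nat) (a b : 'I_n).
Local Open Scope nat_scope.
Local Open Scope group_scope.

Definition inversions s : {set 'I_n * 'I_n} :=
  [set p : 'I_n * 'I_n | (p.1 < p.2) && (s p.2 < s p.1)].
Definition ninv s := #|inversions s|.

(* Descents on the left: with MathComp's order of multiplication the          *)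
(* composite of s followed by s_i is [s * sadj n i].                          *)
Definition desc s i := ninv (s * sadj n i) < ninv s.

Lemma sadj_tperm i : 0 < i < n ->
  exists a b, [/\ i = b, b = a.+1 :> nat & sadj n i = tperm a b].
Proof.
move=> hi; have hp : i.-1 < n by lia.
have hn : i < n by lia.
exists (Ordinal hp), (Ordinal hn); split=> //=; first by lia.
by rewrite /sadj !insubT.
Qed.

Lemma sadjK i : sadj n i * sadj n i = 1.
Proof. rewrite /sadj; case: (insub i.-1 : option 'I_n) => [a|]; last by rewrite mulg1.
by case: (insub i : option 'I_n) => [b|]; rewrite ?tperm2 ?mulg1. Qed.

Lemma mulg_sadjK i : cancel (fun s => s * sadj n i) (fun s => s * sadj n i).
Proof. by move=> s; rewrite -mulgA sadjK mulg1. Qed.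

(** Exchanging the neighbouring values a and b affects no comparison except that of their two
    positions, which becomes an inversion. *)
Lemma ninv_asc s a b : b = a.+1 :> nat -> s^-1 a < s^-1 b ->
  ninv (s * tperm a b) = (ninv s).+1.
Proof.
move=> ab hs; pose p := (s^-1 a, s^-1 b).
have np : p \notin inversions s by rewrite inE /= !permKV; lia.
rewrite /ninv; suff -> : inversions (s * tperm a b) = p |: inversions s.
  by rewrite cardsU1 np.
apply/setP=> -[x y]; rewrite !inE !permM xpair_eqE /=.
rewrite -!(can2_eq (permK s) (permKV s)).
have nxy : s x = s y :> nat -> x = y by move=> h; apply: (@perm_inj _ s); apply: val_inj.
have xa : s x = a -> x = s^-1 a :> nat by move=> <-; rewrite permK.
have xb : s x = b -> x = s^-1 b :> nat by move=> <-; rewrite permK.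
have ya : s y = a -> y = s^-1 a :> nat by move=> <-; rewrite permK.
have yb : s y = b -> y = s^-1 b :> nat by move=> <-; rewrite permK.
have neq (c d : 'I_n) : c <> d -> c <> d :> nat by move=> h /val_inj.
move: xa xb ya yb; rewrite -!val_eqE /=.
case: tpermP => [xa|xb|/neq xna /neq xnb]; case: tpermP => [ya|yb|/neq yna /neq ynb];
  rewrite ?xa ?xb ?ya ?yb => h1 h2 h3 h4;
  try (have {}h1 := h1 erefl); try (have {}h2 := h2 erefl);
  try (have {}h3 := h3 erefl); try (have {}h4 := h4 erefl); lia.
Qed.

Lemma sadjE a b : b = a.+1 :> nat -> sadj n b = tperm a b.
Proof.
move=> ab; have hb : 0 < b < n by have := ltn_ord b; lia.
have [a' [b' [/val_inj <- ab' ->]]] := sadj_tperm hb.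
by congr tperm; apply: val_inj => /=; lia.
Qed.

Lemma tperm_permV s a b : (s * tperm a b)^-1 =1 s^-1 \o tperm a b.
Proof. by move=> x; rewrite invMg tpermV permM. Qed.

Lemma ninv_inv s a b : b = a.+1 :> nat -> s^-1 b < s^-1 a ->
  ninv s = (ninv (s * tperm a b)).+1.
Proof.
move=> ab hs; rewrite -(@ninv_asc _ a b) // ?tperm_permV /= ?tpermL ?tpermR //.
by rewrite -mulgA tperm2 mulg1.
Qed.

Lemma descE s a b : b = a.+1 :> nat -> desc s b = (s^-1 b < s^-1 a).
Proof.
move=> ab; rewrite /desc (sadjE ab).
case: (ltngtP (s^-1 b) (s^-1 a)) => [h|h|/val_inj /perm_inj /(congr1 val) /= e]; last by lia.
  by rewrite (ninv_inv ab h) ltnSn.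
by rewrite (ninv_asc ab h) ltnNge leqnSn.
Qed.

Lemma ninv_desc s i : 0 < i < n -> desc s i -> ninv s = (ninv (s * sadj n i)).+1.
Proof.
by case/sadj_tperm=> a [b [-> ab ->]]; rewrite (descE s ab); apply: ninv_inv.
Qed.

Lemma ninv_ndesc s i : 0 < i < n -> ~~ desc s i ->
  ninv (s * sadj n i) = (ninv s).+1.
Proof.
case/sadj_tperm=> a [b [-> ab ->]]; rewrite (descE s ab) -leqNgt => h.
apply: ninv_asc => //; rewrite ltn_neqAle h andbT.
by apply/eqP=> /val_inj /perm_inj /(congr1 val) /= e; lia.
Qed.

Lemma desc_sadj s i : 0 < i < n -> desc (s * sadj n i) i = ~~ desc s i.
Proof.
move=> hi; apply/idP/idP => [|/(ninv_ndesc hi)].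
  by move/(ninv_desc hi); rewrite mulg_sadjK /desc -leqNgt => ->.
by rewrite /desc mulg_sadjK => ->.
Qed.

Lemma wperm_cons i w : wperm n (i :: w) = wperm n w * sadj n i.
Proof. by rewrite /wperm rev_cons big_rcons. Qed.

Lemma wperm_nil : wperm n [::] = 1.
Proof. by rewrite /wperm big_nil. Qed.

Lemma ninv_wperm w : word_ok n w -> ninv (wperm n w) <= size w.
Proof.
elim: w => [_|i w IH /= /andP[hi hw]].
  rewrite wperm_nil leqn0 cards_eq0; apply/eqP/setP => -[x y].
  by rewrite !inE /= !perm1; lia.
rewrite wperm_cons; have := IH hw; case hd: (desc (wperm n w) i).
  by have := ninv_desc hi hd; lia.
by rewrite ninv_ndesc ?hd.
Qed.

(** Without descents s^-1 increases on neighbours, hence everywhere, and so does s. An increasing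
    permutation p has x <= p x; for s and s^-1 together this forces the identity. *)
Lemma ndesc_perm1 s : (forall i, 0 < i < n -> ~~ desc s i) -> s = 1.
Proof.
move=> nd.
have inc_id (p : 'S_n) : {homo p : x y / x < y} -> forall x : 'I_n, x <= p x.
  move=> hp [m hm]; elim: m hm => //= m IH hm.
  by apply: leq_ltn_trans (IH (ltnW hm)) _; apply: hp => /=.
have incV : {homo s^-1 : x y / x < y}.
  move=> x [y hy]; elim: y hy => //= y IH hy xy.
  have hy' := ltnW hy.
  have ys : s^-1 (Ordinal hy') < s^-1 (Ordinal hy).
    have := nd y.+1 hy; rewrite (@descE s (Ordinal hy') (Ordinal hy)) // -leqNgt => h.
    rewrite ltn_neqAle h andbT; apply/eqP=> /val_inj /perm_inj /(congr1 val) /=; lia.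
  move: xy; rewrite ltnS leq_eqVlt => /orP[/eqP e|/(IH hy')]; last by move/ltn_trans; apply.
  by rewrite (_ : x = Ordinal hy') //; apply: val_inj.
have inc : {homo s : x y / x < y}.
  move=> x y xy; case: (ltngtP (s x) (s y)) => // [/incV|/val_inj /perm_inj e].
    by rewrite !permK; lia.
  by rewrite e ltnn in xy.
apply/permP=> x; rewrite perm1; apply: val_inj; apply/eqP; rewrite eqn_leq inc_id // andbT.
by rewrite -{2}(permK s x) inc_id.
Qed.

Lemma exists_word s : exists w, [/\ word_ok n w, wperm n w = s & size w = ninv s].
Proof.
have [m] := ubnP (ninv s); elim: m s => // m IH s hm.
case: (pselect (exists2 i, 0 < i < n & desc s i)) => [[i hi hd]|nd].
  have e := ninv_desc hi hd.
  have [|w [hw ws sw]] := IH (s * sadj n i); first by rewrite -ltnS -e.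
  by exists (i :: w); rewrite /= hi hw wperm_cons ws mulg_sadjK sw e.
have -> : s = 1 by apply: ndesc_perm1 => i hi; apply/negP=> hd; apply: nd; exists i.
exists [::]; split=> //; first exact: wperm_nil.
by have := @ninv_wperm [::] isT; rewrite wperm_nil leqn0 => /eqP ->.
Qed.

(** Words attaining the lower bound of [ninv_wperm] exist by [exists_word], so length is the number
    of inversions. *)
Lemma reducedP s w :
  reduced_word s w <-> [/\ word_ok n w, wperm n w = s & size w = ninv s].
Proof.
split=> -[hw ws h]; split=> //.
  apply/eqP; rewrite eqn_leq -{2}ws ninv_wperm // andbT.
  by have [w' [hw' ws' <-]] := exists_word s; apply: h.
by move=> w' hw' ws'; rewrite h -ws' ninv_wperm.
Qed.

Lemma redwordP s : reduced_word s (redword s).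
Proof.
apply: (classical_sets.xgetPex [::]).
by have [w hw] := exists_word s; exists w; apply/reducedP.
Qed.

Lemma plengthE s : plength s = ninv s.
Proof. by have /reducedP[] := redwordP s. Qed.

Lemma reduced_cons i s w : reduced_word s (i :: w) ->
  [/\ 0 < i < n, desc s i & reduced_word (s * sadj n i) w].
Proof.
case/reducedP=> /= /andP[hi hw]; rewrite wperm_cons => <- h.
have hle := ninv_wperm hw; have hd : desc (wperm n w * sadj n i) i.
  rewrite desc_sadj //; apply/negP => /(ninv_desc hi); lia.
split=> //; apply/reducedP; rewrite mulg_sadjK; split=> //.
by move: (ninv_desc hi hd); rewrite mulg_sadjK -h => -[].
Qed.

Lemma reduced_desc i s w : 0 < i < n -> desc s i ->
  reduced_word (s * sadj n i) w -> reduced_word s (i :: w).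
Proof.
move=> hi hd /reducedP[hw ws sw]; apply/reducedP.
by rewrite /= hi hw wperm_cons ws mulg_sadjK sw -ninv_desc.
Qed.

Section Matsumoto.
Variables (V : Type) (T : nat -> V -> V).
Hypothesis braid : forall i v, 0 < i -> i.+1 < n ->
  T i (T i.+1 (T i v)) = T i.+1 (T i (T i.+1 v)).
Hypothesis comm : forall i j v, 0 < i < n -> 0 < j < n -> i.+1 < j ->
  T i (T j v) = T j (T i v).

(** Induction on the length. If the words begin with distinct i and j, both are descents of s, so s
    also has reduced words beginning with i j and j i, or with i j i and j i j when i and j are
    neighbours, followed by a common word x. By induction the given words act like these two, which
    differ by one relation. *)
Lemma matsumoto s w w' v : reduced_word s w -> reduced_word s w' ->
  foldr T v w = foldr T v w'.
Proof.
have [m] := ubnP (size w); elim: m s w w' => // m IH s w w' hm hw hw'.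
have : size w = size w' by case/reducedP: hw => _ _ ->; case/reducedP: hw' => _ _ ->.
case: w hm hw => [|i u] hm hw; case: w' hw' => [|j u'] hw' //= [su].
wlog ij : i j u u' hm hw hw' su / i <= j.
  move=> H; case: (leqP i j) => ij; first exact: H.
  by symmetry; apply: H => //; rewrite ?(ltnW ij) //= -su.
move: ij; rewrite leq_eqVlt => /orP[/eqP ij|ij].
  have [_ _ hu] := reduced_cons hw; have [_ _ hu'] := reduced_cons hw'.
  by rewrite -ij (IH _ u u' _ hu) // ij.
have [hi di hu] := reduced_cons hw; have [hj dj hu'] := reduced_cons hw'.
have [a [b [eb ab sb]]] := sadj_tperm hi; have [c [d [ed cd sd]]] := sadj_tperm hj.
have tD (x y z : 'I_n) : x != z :> nat -> y != z :> nat -> tperm x y z = z.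
  by move=> xz yz; apply: tpermD.
(* The case j > i + 1 is settled first; j = i + 1 remains. *)
move: ij; rewrite leq_eqVlt => /orP[/eqP ij|ij]; last first.
  have [tc td] : tperm a b c = c /\ tperm a b d = d by split; apply: tD; lia.
  have [ta tb] : tperm c d a = a /\ tperm c d b = b by split; apply: tD; lia.
  have dj' : desc (s * sadj n i) j.
    by rewrite sb {1}ed (descE _ cd) !tperm_permV /= tc td -(descE _ cd) -ed.
  have di' : desc (s * sadj n j) i.
    by rewrite sd {1}eb (descE _ ab) !tperm_permV /= ta tb -(descE _ ab) -eb.
  have eij : s * sadj n i * sadj n j = s * sadj n j * sadj n i.
    rewrite -!mulgA; congr (_ * _); rewrite sb sd -{1}tc -{1}td -tpermJ.
    by rewrite conjgE tpermV !mulgA tperm2 mul1g.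
  pose x := redword (s * sadj n i * sadj n j).
  have hx : reduced_word (s * sadj n i * sadj n j) x := redwordP _.
  have hx' := hx; rewrite eij in hx'.
  rewrite (IH _ u (j :: x) _ hu); first 1 last.
  - by [].
  - exact: reduced_desc.
  rewrite (IH _ u' (i :: x) _ hu'); first 1 last.
  - by rewrite -su.
  - exact: reduced_desc.
  exact: comm.
have bc : b = c by apply: val_inj => /=; lia.
move: cd sd; rewrite -bc => {c bc} cd sd.
have [tad tbd] : tperm a b d = d /\ tperm b d a = a by split; apply: tD; lia.
pose x := redword (s * sadj n i * sadj n j * sadj n i).
have hx : reduced_word (s * sadj n i * sadj n j * sadj n i) x := redwordP _.
have eij : s * sadj n i * sadj n j * sadj n i = s * sadj n j * sadj n i * sadj n j.
  rewrite -!mulgA; congr (_ * _); rewrite sb sd.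
  have tb : tperm b d = tperm a d ^ tperm a b by rewrite tpermJ tpermL tad.
  have ta : tperm a b = tperm a d ^ tperm b d by rewrite tpermJ tpermR tbd.
  have -> : tperm a b * (tperm b d * tperm a b) = tperm a d.
    by rewrite tb conjgE tpermV !mulgA tperm2 mul1g -mulgA tperm2 mulg1.
  by rewrite {1}ta conjgE tpermV !mulgA tperm2 mul1g -mulgA tperm2 mulg1.
have hx' := hx; rewrite eij in hx'.
have pab : s^-1 b < s^-1 a by rewrite -(descE _ ab) -eb.
have pbd : s^-1 d < s^-1 b by rewrite -(descE _ cd) -ed.
rewrite (IH _ u (j :: i :: x) _ hu); first 1 last.
- by [].
- apply: reduced_desc => //.
    by rewrite sb {1}ed (descE _ cd) !tperm_permV /= tpermR tad (ltn_trans pbd).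
  apply: reduced_desc => //.
  by rewrite sb sd {1}eb (descE _ ab) !tperm_permV /= !tperm_permV /= tpermL tbd tpermL tad.
rewrite (IH _ u' (i :: j :: x) _ hu'); first 1 last.
- by rewrite -su.
- apply: reduced_desc => //.
    by rewrite sd {1}eb (descE _ ab) !tperm_permV /= tpermL tbd (ltn_trans pbd).
  apply: reduced_desc => //.
  by rewrite sd sb {1}ed (descE _ cd) !tperm_permV /= !tperm_permV /= tad !tpermR tbd.
rewrite -ij /=; apply: braid; lia.
Qed.

End Matsumoto.
End Length.

(** * Words in braid generators *)

Section BraidWords.
Variables (V : Type) (A : nat -> V -> V) (n : nat).
Hypothesis braid : forall i v, (0 < i)%N -> (i.+1 < n)%N ->
  A i (A i.+1 (A i v)) = A i.+1 (A i (A i.+1 v)).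
Hypothesis comm : forall i j v, (0 < i < n)%N -> (0 < j < n)%N -> (i.+1 < j)%N ->
  A i (A j v) = A j (A i v).

Lemma foldr_comm (B : V -> V) s v :
  (forall j w, j \in s -> B (A j w) = A j (B w)) -> B (foldr A v s) = foldr A (B v) s.
Proof.
elim: s => //= i s IH h; rewrite h ?mem_head // IH // => j w js.
by apply: h; rewrite inE js orbT.
Qed.

Lemma iota_split i a m : (a <= i)%N -> (i.+1 < a + m)%N ->
  iota a m = iota a (i - a) ++ [:: i, i.+1 & iota i.+2 (a + m - i.+2)].
Proof.
move=> ai im; rewrite {1}(_ : m = (i - a) + (a + m - i.+2).+2)%N; last by lia.
by rewrite iotaD subnKC.
Qed.

(** A_i passes the letters above i + 1, becomes A_(i+1) by one braid relation, and passes the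
    letters below i. *)
Lemma foldr_braid_up a m i v : (0 < a)%N -> (a + m <= n)%N ->
    (a <= i)%N -> (i.+1 < a + m)%N ->
  foldr A (A i v) (iota a m) = A i.+1 (foldr A v (iota a m)).
Proof.
move=> a0 amn ai im; rewrite (iota_split ai im) !foldr_cat /=.
rewrite -[foldr A (A i v) _](@foldr_comm (A i)) => [|j w]; last first.
  by rewrite mem_iota => hj; apply: comm; lia.
rewrite braid; [|lia|lia].
rewrite -[LHS](@foldr_comm (A i.+1)) // => j w.
by rewrite mem_iota => hj; rewrite [RHS]comm //; lia.
Qed.

Lemma foldr_braid_down a m i v : (0 < a)%N -> (a + m <= n)%N ->
    (a <= i)%N -> (i.+1 < a + m)%N ->
  foldr A (A i.+1 v) (rev (iota a m)) = A i (foldr A v (rev (iota a m))).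
Proof.
move=> a0 amn ai im; rewrite (iota_split ai im) rev_cat !rev_cons -!cats1 -!catA.
rewrite !foldr_cat /= -[foldr A (A i.+1 v) _](@foldr_comm (A i.+1)) => [|j w]; last first.
  by rewrite mem_rev mem_iota => hj; rewrite [RHS]comm //; lia.
rewrite -braid; [|lia|lia].
rewrite -[LHS](@foldr_comm (A i)) // => j w.
by rewrite mem_rev mem_iota => hj; apply: comm; lia.
Qed.

End BraidWords.

(** * Reduced words in Young subgroups *)

Section Young.
Variables (n k : nat).
Implicit Types (s : 'S_n).

Lemma young_sadj s i : (k < i < n)%N -> young k (s * sadj n i)%g = young k s.
Proof.
move=> hi; have /sadj_tperm[a [b [eb ab ->]]] : (0 < i < n)%N by lia.
have D (x : 'I_n) : (x < k)%N -> tperm a b x = x.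
  by move=> hx; apply: tpermD; rewrite -val_eqE /=; lia.
apply: eq_forallb => x; case hx: (x < k)%N => //=; rewrite permM.
apply/eqP/eqP => [h|->]; last exact: D.
by apply: (@perm_inj _ (tperm a b)); rewrite h D.
Qed.

(** For i <= k the smaller value exchanged by s_i is fixed by s; a descent would put the larger
    value at an even smaller position, which is fixed as well. *)
Lemma young_desc s i : (0 < i < n)%N -> young k s -> desc s i -> (k < i)%N.
Proof.
case/sadj_tperm=> a [b [eb ab _]] /forallP hs; rewrite {1}eb (descE _ ab) => d.
rewrite ltnNge; apply/negP=> ik; have ak : (a < k)%N by lia.
have /eqP sa := implyP (hs a) ak.
have sa' : s^-1%g a = a by rewrite -{1}sa permK.
rewrite sa' in d; have /eqP := implyP (hs (s^-1%g b)) (ltn_trans d ak).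
by rewrite permKV => e; rewrite -e in d; lia.
Qed.

Lemma young_reduced s w : young k s -> reduced_word s w -> all (fun i => k < i < n)%N w.
Proof.
elim: w s => //= i w IH s ys /reduced_cons[hi d hw].
have ki := young_desc hi ys d; rewrite ki; case/andP: (hi) => _ -> /=.
by apply: (IH _ _ hw); rewrite young_sadj // ki; case/andP: hi.
Qed.

End Young.

(** Transcendence over the rationals, with denominators cleared. *)
Definition transcendental (K : fieldType) (q : K) : Prop :=
  forall p : {poly int}, p != 0 -> (map_poly intr p).[q] != 0.

(** * Transcendental parameters *)

Section GenericParameter.
Variables (K : fieldType) (q : K).
Hypothesis hq : transcendental q.

Lemma transcendental_neq0 : q != 0.
Proof. by have := @hq 'X; rewrite polyX_eq0 map_polyX hornerX; apply. Qed.

Lemma transcendental_expr_neq1 m : 1 - q ^+ m.+1 != 0.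
Proof.
have /hq : (1 - 'X^(m.+1) : {poly int}) != 0.
  by rewrite -size_poly_eq0 addrC size_polyDl size_polyN ?size_polyXn // size_poly1.
by rewrite rmorphB rmorph1 /= map_polyXn !hornerE.
Qed.

Lemma transcendental_neq1 : q - 1 != 0.
Proof. by have := transcendental_expr_neq1 0; rewrite expr1 -oppr_eq0 opprB. Qed.

Lemma qfact_neq0 m : qfact q m != 0.
Proof.
rewrite /qfact prodf_seq_neq0; apply/allP => -[|i]; rewrite mem_index_iota //= => _.
by rewrite mulf_neq0 ?invr_neq0 ?transcendental_expr_neq1 //
  (transcendental_expr_neq1 0).
Qed.

(** Multiplied by q^N, with N the largest exponent, the sum becomes an integer polynomial in q. That
    polynomial is nonzero because its value at 1 counts the summands. *)
Lemma sum_exprV_neq0 (I : finType) (P : pred I) (l : I -> nat) (i0 : I) :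
  P i0 -> \sum_(i | P i) (q ^+ l i)^-1 != 0.
Proof.
move=> Pi0; pose N := \max_(i | P i) l i.
pose p : {poly int} := \sum_(i | P i) 'X^(N - l i).
have p1 : p.[1] = #|P|%:R.
  rewrite horner_sum -sumr_const; apply: eq_bigr => i _.
  by rewrite hornerXn expr1n.
have p0 : p != 0.
  apply/eqP => e; move: p1; rewrite e horner0 => /esym/eqP.
  by rewrite Num.Theory.pnatr_eq0 => /eqP/card0_eq/(_ i0); rewrite !inE unfold_in Pi0.
have e : (map_poly intr p).[q] = q ^+ N * \sum_(i | P i) (q ^+ l i)^-1.
  rewrite rmorph_sum horner_sum mulr_sumr; apply: eq_bigr => i Pi /=.
  rewrite map_polyXn hornerXn expfB_cond //.
  by rewrite (negbTE transcendental_neq0) /=; apply: leq_bigmax_cond.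
by have := hq p0; rewrite e mulf_eq0 negb_or => /andP[].
Qed.

End GenericParameter.

(** * Modules over the positive DAHA *)

Section DAHAModule.
Variables (K : fieldType) (q t : K) (n : nat) (V : gmod (DAHA q t n)).
Implicit Types (u v w : V) (e : expr K true (dgen n)).

Lemma dact_linear e : linear (@dact K q t n V e).
Proof. by move=> c v w; rewrite /dact ga_linr. Qed.
HB.instance Definition _ e := GRing.isLinear.Build K V V _ (@dact K q t n V e) (dact_linear e).

Lemma dact_rel e e' v : drel q t e e' -> dact e v = dact e' v.
Proof. by move=> h; rewrite /dact /dcl; congr (gm_act V _ v); apply/pclP/pc_rel. Qed.

(** The action with its arguments exchanged, so that linearity in the algebra element is available
    as a canonical structure. *)
Definition act_on v (a : palg (DAHA q t n)) : V := gm_act V a v.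
Lemma act_on_linear v : linear (act_on v).
Proof. by move=> c a b; rewrite /act_on ga_linl. Qed.
HB.instance Definition _ v := GRing.isLinear.Build K (palg (DAHA q t n)) V _
  (act_on v) (act_on_linear v).

Lemma dactM e e' v : dact (e * e')%X v = dact e (dact e' v).
Proof. by rewrite /dact /dcl pcl_mul ga_mul. Qed.
Lemma dactD e e' v : dact (e + e')%X v = dact e v + dact e' v.
Proof. by rewrite /dact /dcl pclD -?/(act_on v _) linearD. Qed.
Lemma dactN e v : dact (EOpp e) v = - dact e v.
Proof. by rewrite /dact /dcl pclN -?/(act_on v _) linearN. Qed.
Lemma dactZ c e v : dact (c *: e)%X v = c *: dact e v.
Proof. by rewrite /dact /dcl pclZ -?/(act_on v _) linearZ. Qed.
Lemma dact1 v : dact 1%X v = v.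
Proof. by rewrite /dact; exact: ga_one. Qed.
Lemma dact0 v : dact 0%X v = 0.
Proof. by rewrite /dact /dcl pcl0 -?/(act_on v _) linear0. Qed.
Definition dactE := (dactM, dactD, dactN, dactZ, dact1, dact0).

Lemma dact_eprod (f : nat -> expr K true (dgen n)) s v :
  dact (eprod f s) v = foldr (fun i => dact (f i)) v s.
Proof. by elim: s => [|i s IH] /=; rewrite ?dactE // IH. Qed.

(** * The finite Hecke algebra *)

Hypothesis hq : transcendental q.
Let q0 : q != 0 := transcendental_neq0 hq.

Local Notation T i := (@dact K q t n V (eT K n i)).
Local Notation I i := (@dact K q t n V (eTV q n i)).
Local Notation X i := (@dact K q t n V (eX K n i)).
Local Notation Y i := (@dact K q t n V (eY K n i)).
Local Notation Tw := (fun i => T i).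
Local Notation Iw := (fun i => I i).
Local Notation Xw := (fun i => X i).

Lemma T_quad i v : (0 < i < n)%N -> T i (T i v) = (1 - q) *: T i v + q *: v.
Proof.
move=> hi; have := dact_rel v (dr_quad q t hi); rewrite !dactE.
rewrite linearD linearZ /= => /eqP; rewrite subr_eq0 => /eqP h.
by rewrite scalerBl scale1r addrAC -h addrK.
Qed.

Lemma I_T i v : (0 < i < n)%N -> I i (T i v) = v.
Proof.
move=> hi; rewrite /eTV !dactE T_quad // addrAC -scalerDl subrKA subrr scale0r add0r.
by rewrite scalerA mulVf // scale1r.
Qed.

Lemma T_I i v : (0 < i < n)%N -> T i (I i v) = v.
Proof.
move=> hi; rewrite /eTV !dactE linearZ linearD linearZ /= T_quad //.
rewrite addrAC -scalerDl subrKA subrr scale0r add0r.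
by rewrite scalerA mulVf // scale1r.
Qed.

Lemma T_inj i : (0 < i < n)%N -> injective (T i : V -> V).
Proof. by move=> hi v w h; rewrite -(I_T v hi) h I_T. Qed.

Lemma IE i v : I i v = q^-1 *: (T i v + (q - 1) *: v).
Proof. by rewrite /eTV !dactE. Qed.

Lemma TE i v : T i v = q *: I i v + (1 - q) *: v.
Proof.
by rewrite IE scalerA mulfV // scale1r -addrA -scalerDl subrKA subrr scale0r addr0.
Qed.

Lemma T_braid i v : (0 < i)%N -> (i.+1 < n)%N ->
  T i (T i.+1 (T i v)) = T i.+1 (T i (T i.+1 v)).
Proof. by move=> i0 hi; rewrite -!dactM; apply: dact_rel; apply: dr_braid. Qed.

Lemma T_comm i j v : (0 < i < n)%N -> (0 < j < n)%N -> (i.+1 < j)%N || (j.+1 < i)%N ->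
  T i (T j v) = T j (T i v).
Proof. by move=> hi hj hij; rewrite -!dactM; apply: dact_rel; apply: dr_TT. Qed.

Lemma I_comm i (B : V -> V) v : (0 < i < n)%N -> (forall w, T i (B w) = B (T i w)) ->
  I i (B v) = B (I i v).
Proof. by move=> hi h; apply: (T_inj hi); rewrite h !T_I. Qed.

Lemma I_braid i v : (0 < i)%N -> (i.+1 < n)%N ->
  I i (I i.+1 (I i v)) = I i.+1 (I i (I i.+1 v)).
Proof.
move=> i0 hi; have h1 : (0 < i < n)%N by lia.
apply: (T_inj h1); rewrite T_I //; apply: (@T_inj i.+1) => //; rewrite T_I //.
apply: (T_inj h1); rewrite T_I // T_braid // T_I //.
by rewrite T_I // T_I.
Qed.

Lemma II_comm i j v : (0 < i < n)%N -> (0 < j < n)%N -> (i.+1 < j)%N || (j.+1 < i)%N ->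
  I i (I j v) = I j (I i v).
Proof.
move=> hi hj hij; apply: I_comm => // w; symmetry; apply: I_comm => // z.
by apply: T_comm => //; rewrite orbC.
Qed.

(** * The operators epsilon_k and the spaces L_k(V) *)

Definition young_invariant k u := forall j, (k < j < n)%N -> T j u = u.

Lemma young_invariant_I k u j : young_invariant k u -> (k < j < n)%N -> I j u = u.
Proof. by move=> h hj; rewrite -{1}(h j hj) I_T //; lia. Qed.

(** This is epsilon_k up to the scalar displayed in [deps_act]. *)
Definition symm k u : V :=
  \sum_(s : 'S_n | young k s) (q ^+ plength s)^-1 *: foldr Tw u (redword s).

Lemma deps_act k u : gm_act V (deps q t n k) u =
  ((qfact q (n - k))^-1 * q ^+ 'C(n - k, 2)) *: symm k u.
Proof.
rewrite /deps -[LHS]/(act_on u _) linearZ linear_sum -scalerA; congr (_ *: _).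
rewrite /symm scaler_sumr; apply: eq_bigr => s _.
by rewrite linearZ scalerA -dact_eprod.
Qed.

Lemma T_redword s i u : (0 < i < n)%N -> ~~ desc s i ->
  T i (foldr Tw u (redword s)) = foldr Tw u (redword (s * sadj n i)%g).
Proof.
move=> hi nd; rewrite -[LHS]/(foldr Tw u (i :: redword s)).
apply: (@matsumoto n V Tw _ _ (s * sadj n i)%g); last exact: redwordP.
- by move=> j v j0 hj; apply: T_braid.
- by move=> j l v hj hl jl; apply: T_comm => //; rewrite jl.
by apply: reduced_desc => //; rewrite ?desc_sadj // mulg_sadjK; apply: redwordP.
Qed.

(** The sum splits into pairs T_s + q^-1 T_i T_s, up to powers of q, with i not a descent of s; by
    the quadratic relation T_i (1 + q^-1 T_i) = 1 + q^-1 T_i. *)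
Lemma symm_invariant k u : young_invariant k (symm k u).
Proof.
move=> i hi; have hi0 : (0 < i < n)%N by lia.
pose f (s : 'S_n) : V := (q ^+ plength s)^-1 *: foldr Tw u (redword s).
have -> : symm k u =
    \sum_(s : 'S_n | young k s && ~~ desc s i) (f s + f (s * sadj n i)%g).
  rewrite /symm (bigID (fun s => desc s i)) /= addrC big_split /=; congr (_ + _).
  rewrite (reindex_inj (can_inj (@mulg_sadjK n i))) /=.
  by apply: eq_bigl => s; rewrite young_sadj // desc_sadj.
rewrite linear_sum; apply: eq_bigr => s /andP[ys nd]; rewrite /f linearD !linearZ /=.
rewrite -T_redword // T_quad // !plengthE ninv_ndesc // exprS invfM.
set a := (q ^+ _)^-1; rewrite scalerDr !scalerA.
rewrite [q^-1 * a * q]mulrAC mulVf // mul1r addrA -scalerDl addrC; congr (_ + _ *: _).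
by rewrite mulrBr mulr1 [_ * q]mulrAC mulVf // mul1r addrC subrK.
Qed.

Lemma symm_young_invariant k u : young_invariant k u ->
  symm k u = (\sum_(s : 'S_n | young k s) (q ^+ plength s)^-1) *: u.
Proof.
move=> hu; rewrite scaler_suml; apply: eq_bigr => s ys; congr (_ *: _).
elim: (redword s) (young_reduced ys (redwordP s)) => //= i w IH /andP[hi hw].
by rewrite IH // hu.
Qed.

Definition Xs k u : V := foldr Xw u (iota 1 k).

Definition Ldelem k v := exists2 u, young_invariant k u & v = Xs k u.

Lemma LspaceP k v : Lspace V k v <-> Ldelem k v.
Proof.
have LE u : gm_act V (pmul (dcl q t (eXs K n k)) (deps q t n k)) u =
    Xs k (gm_act V (deps q t n k) u) by rewrite ga_mul -[LHS]/(dact (eXs K n k) _) dact_eprod.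
have inv_scale (c : K) u : young_invariant k u -> young_invariant k (c *: u).
  by move=> h j hj; rewrite linearZ /= h.
split=> [[u ->]|[u hu ->]].
  rewrite LE deps_act; eexists; last by [].
  by apply: inv_scale; apply: symm_invariant.
(* The scalar by which epsilon_k acts on vectors fixed by the T_j with j > k; it is divided out in
   the witness. *)
pose c := ((qfact q (n - k))^-1 * q ^+ 'C(n - k, 2)) *
  \sum_(s : 'S_n | young k s) (q ^+ plength s)^-1.
have c0 : c != 0.
  rewrite !mulf_neq0 ?invr_neq0 ?qfact_neq0 ?expf_neq0 //.
  apply: (@sum_exprV_neq0 _ _ hq _ _ _ 1%g).
  by apply/forallP => x; rewrite perm1 eqxx implybT.
exists (c^-1 *: u); rewrite LE deps_act symm_young_invariant; last exact: inv_scale.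
by rewrite !scalerA mulfV // scale1r.
Qed.

(** * Ordered products of the T_i and of their inverses *)

Lemma iota_rcons a m : iota a m.+1 = rcons (iota a m) (a + m).
Proof. by rewrite -addn1 iotaD cats1. Qed.

(* Iup a m = T_a^-1 ... T_(a+m-1)^-1 and Idown a m = T_(a+m-1)^-1 ... T_a^-1. *)
Definition Iup a m v : V := foldr Iw v (iota a m).
Definition Idown a m v : V := foldr Iw v (rev (iota a m)).
Definition Tup a m v : V := foldr Tw v (iota a m).
Definition Tdown a m v : V := foldr Tw v (rev (iota a m)).

Lemma foldr_linear (f : nat -> expr K true (dgen n)) s :
  linear (fun v => foldr (fun i => @dact K q t n V (f i)) v s).
Proof. by elim: s => //= i s IH c v w; rewrite IH linearP. Qed.
HB.instance Definition _ a m :=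
  GRing.isLinear.Build K V V _ (Iup a m) (foldr_linear _ (iota a m)).
HB.instance Definition _ a m :=
  GRing.isLinear.Build K V V _ (Idown a m) (foldr_linear _ (rev (iota a m))).
HB.instance Definition _ a m :=
  GRing.isLinear.Build K V V _ (Tup a m) (foldr_linear _ (iota a m)).
HB.instance Definition _ a m :=
  GRing.isLinear.Build K V V _ (Tdown a m) (foldr_linear _ (rev (iota a m))).
HB.instance Definition _ k :=
  GRing.isLinear.Build K V V _ (Xs k) (foldr_linear _ (iota 1 k)).

Lemma IdownS a m v : Idown a m.+1 v = I (a + m) (Idown a m v).
Proof. by rewrite /Idown iota_rcons rev_rcons. Qed.
Lemma IdownSr a m v : Idown a m.+1 v = Idown a.+1 m (I a v).
Proof. by rewrite /Idown /= rev_cons foldr_rcons. Qed.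
Lemma TdownS a m v : Tdown a m.+1 v = T (a + m) (Tdown a m v).
Proof. by rewrite /Tdown iota_rcons rev_rcons. Qed.
Lemma IupS a m v : Iup a m.+1 v = Iup a m (I (a + m) v).
Proof. by rewrite /Iup iota_rcons foldr_rcons. Qed.
Lemma TupS a m v : Tup a m.+1 v = Tup a m (T (a + m) v).
Proof. by rewrite /Tup iota_rcons foldr_rcons. Qed.
Lemma XsS k v : Xs k.+1 v = Xs k (X k.+1 v).
Proof. by rewrite /Xs iota_rcons foldr_rcons. Qed.
Lemma IdownD a m l v : Idown a (m + l) v = Idown (a + m) l (Idown a m v).
Proof. by rewrite /Idown iotaD rev_cat foldr_cat. Qed.
Lemma TdownD a m l v : Tdown a (m + l) v = Tdown (a + m) l (Tdown a m v).
Proof. by rewrite /Tdown iotaD rev_cat foldr_cat. Qed.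

Lemma Iup_up a m i v : (0 < a)%N -> (a + m <= n)%N -> (a <= i)%N -> (i.+1 < a + m)%N ->
  Iup a m (I i v) = I i.+1 (Iup a m v).
Proof.
move=> a0 amn; apply: (@foldr_braid_up _ Iw n) => // [j w|j l w hj hl jl].
  exact: I_braid.
by apply: II_comm => //; rewrite jl.
Qed.

Lemma Iup_upT a m i v : (0 < a)%N -> (a + m <= n)%N -> (a <= i)%N -> (i.+1 < a + m)%N ->
  Iup a m (T i v) = T i.+1 (Iup a m v).
Proof.
move=> a0 amn ai im; apply: etrans (congr1 _ (esym _)) _; last first.
  by rewrite -[in RHS](@I_T i v) ?Iup_up ?T_I //; lia.
by [].
Qed.

Lemma Idown_down a m i v : (0 < a)%N -> (a + m <= n)%N -> (a <= i)%N -> (i.+1 < a + m)%N ->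
  Idown a m (I i.+1 v) = I i (Idown a m v).
Proof.
move=> a0 amn; apply: (@foldr_braid_down _ Iw n) => // [j w|j l w hj hl jl].
  exact: I_braid.
by apply: II_comm => //; rewrite jl.
Qed.

Lemma Tup_up a m i v : (0 < a)%N -> (a + m <= n)%N -> (a <= i)%N -> (i.+1 < a + m)%N ->
  Tup a m (T i v) = T i.+1 (Tup a m v).
Proof.
move=> a0 amn; apply: (@foldr_braid_up _ Tw n) => // [j w|j l w hj hl jl].
  exact: T_braid.
by apply: T_comm => //; rewrite jl.
Qed.

Lemma Tdown_down a m i v : (0 < a)%N -> (a + m <= n)%N -> (a <= i)%N -> (i.+1 < a + m)%N ->
  Tdown a m (T i.+1 v) = T i (Tdown a m v).
Proof.
move=> a0 amn; apply: (@foldr_braid_down _ Tw n) => // [j w|j l w hj hl jl].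
  exact: T_braid.
by apply: T_comm => //; rewrite jl.
Qed.

Lemma Iup_comm (B : V -> V) a m v : (0 < a)%N -> (a + m <= n)%N ->
  (forall i w, (a <= i < a + m)%N -> B (T i w) = T i (B w)) ->
  B (Iup a m v) = Iup a m (B v).
Proof.
move=> a0 amn h; apply: (@foldr_comm _ Iw B) => i w; rewrite mem_iota => hi.
by rewrite (@I_comm i B) //; [lia | move=> z; rewrite h].
Qed.

Lemma Idown_comm (B : V -> V) a m v : (0 < a)%N -> (a + m <= n)%N ->
  (forall i w, (a <= i < a + m)%N -> B (T i w) = T i (B w)) ->
  B (Idown a m v) = Idown a m (B v).
Proof.
move=> a0 amn h; apply: (@foldr_comm _ Iw B) => i w; rewrite mem_rev mem_iota => hi.
by rewrite (@I_comm i B) //; [lia | move=> z; rewrite h].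
Qed.

Lemma Tup_comm (B : V -> V) a m v :
  (forall i w, (a <= i < a + m)%N -> B (T i w) = T i (B w)) ->
  B (Tup a m v) = Tup a m (B v).
Proof.
by move=> h; apply: (@foldr_comm _ Tw B) => i w; rewrite mem_iota => hi; apply: h.
Qed.

Lemma Idown_Tup a m v : (0 < a)%N -> (a + m <= n)%N -> Idown a m (Tup a m v) = v.
Proof.
move=> a0; elim: m v => // m IH v h; rewrite TupS IdownS IH; last by lia.
by rewrite I_T //; lia.
Qed.

Lemma Tdown_Iup a m v : (0 < a)%N -> (a + m <= n)%N -> Tdown a m (Iup a m v) = v.
Proof.
move=> a0; elim: m v => // m IH v h; rewrite IupS TdownS IH; last by lia.
by rewrite T_I //; lia.
Qed.

(** For m = n - a this is d_- on L_a(V) without the factor q - 1; a free m permits inductions and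
    the comparison of n with n + 1. *)
Definition Isum a m v : V := \sum_(l < m.+1) q ^+ l *: Idown a l v.

Lemma Isum_linear a m : linear (Isum a m).
Proof.
move=> c v w; rewrite /Isum scaler_sumr -big_split; apply: eq_bigr => l _ /=.
by rewrite linearP scalerDr !scalerA [c * _]mulrC.
Qed.
HB.instance Definition _ a m := GRing.isLinear.Build K V V _ (Isum a m) (Isum_linear a m).

Lemma IsumS a m v : Isum a m.+1 v = Isum a m v + q ^+ m.+1 *: Idown a m.+1 v.
Proof. by rewrite /Isum big_ord_recr. Qed.

Lemma Isum0 a v : Isum a 0 v = v.
Proof. by rewrite /Isum big_ord1 expr0 scale1r. Qed.

Lemma Isum_comm (B : {linear V -> V}) a m v : (0 < a)%N -> (a + m <= n)%N ->
  (forall i w, (a <= i < a + m)%N -> B (T i w) = T i (B w)) ->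
  B (Isum a m v) = Isum a m (B v).
Proof.
move=> a0 amn h; rewrite /Isum linear_sum; apply: eq_bigr => -[l /= hl] _.
rewrite linearZ /= Idown_comm //; first by lia.
by move=> i w hi; apply: h; lia.
Qed.

Lemma IsumSl a m v : Isum a m.+1 v = v + q *: Isum a.+1 m (I a v).
Proof.
rewrite /Isum big_ord_recl expr0 scale1r scaler_sumr; congr (_ + _).
by apply: eq_bigr => l _; rewrite scalerA -exprS IdownSr.
Qed.

(** For j = a + d, T_j commutes with the letters of the summands l < d and passes through those with
    l > d + 1 as T_(j+1), in both cases fixing v. The summands d and d + 1 combine to a multiple of
    (1 + q T_j^-1) z, which T_j fixes. *)
Lemma Isum_invariant a v : (0 < a <= n)%N -> young_invariant a v ->
  young_invariant a.-1 (Isum a (n - a) v).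
Proof.
move=> han hv j hj.
have [d ej] : {d | j = (a + d)%N} by exists (j - a)%N; lia.
have {hj} hj : (0 < j < n)%N by lia.
suff h r : (a + (d.+1 + r) <= n)%N ->
    T j (Isum a (d.+1 + r) v) = Isum a (d.+1 + r) v.
  by rewrite (_ : n - a = d.+1 + (n - a - d.+1))%N; [apply: h|]; lia.
elim: r => [|r IH] h; last first.
  rewrite addnS IsumS linearD linearZ /= IH; last by lia.
  congr (_ + _ *: _); rewrite -{1}(@young_invariant_I a v j.+1) //; last by lia.
  by rewrite Idown_down ?T_I //; lia.
rewrite addn0 /Isum !big_ord_recr /= IdownS -ej -addrA linearD; congr (_ + _).
  rewrite linear_sum; apply: eq_bigr => -[l /= hl] _; rewrite linearZ /=.
  rewrite Idown_comm ?hv //; try lia.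
  by move=> i w hi; rewrite T_comm //; lia.
set z := Idown a d v; rewrite linearD !linearZ /= T_I //.
rewrite TE exprSr -!scalerA -!scalerDr; congr (_ *: _).
by rewrite scalerBl scale1r -addrA subrK addrC.
Qed.

(** This converts the products of T_i in [Y1_Xs] into the inverse products of d_-. In the induction
    T_(a+m) fixes all summands but the last, where T = q T^-1 + (1 - q) applies. *)
Lemma Tdown_Isum a m v : (0 < a)%N -> (a + m <= n)%N -> young_invariant a v ->
  Tdown a m v = q ^+ m.+1 *: Idown a m v - (q - 1) *: Isum a m v.
Proof.
move=> a0 + hv; elim: m => [|m IH] h.
  rewrite Isum0 /Tdown /Idown /= expr1 -scalerBl subKr scale1r //.
have hm : (0 < a + m < n)%N by lia.
have Tl l : (l < m)%N -> T (a + m) (Idown a l v) = Idown a l v.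
  move=> lm; rewrite Idown_comm ?hv //; try lia.
  by move=> i w hi; rewrite T_comm //; lia.
rewrite TdownS IH; last by lia.
rewrite /Isum !big_ord_recr /= linearB !linearZ /= linearD linear_sum /=.
under eq_bigr => l _ do rewrite linearZ /= Tl //.
rewrite linearZ /= IdownS; set z := Idown a m v; set s := \sum_(_ < _) _.
rewrite TE !scalerDr !scalerA; set y := I _ _.
rewrite !(scalerN, scalerDr, scalerA, opprD) -!scaleNr.
rewrite [LHS](AC (2*(1*2)) ((1*4)*(2*5)*3)) [RHS](AC (1*(1*1*1)) ((1*4)*3*2)) /=.
by rewrite -!scalerDl; congr (_ *: _ + _ *: _ + _); rewrite !exprS; ring.
Qed.

(** * Commutation with the X_i, the Y_i and the rotation pi *)

Lemma I_X_I i v : (0 < i < n)%N -> I i (X i (I i v)) = q^-1 *: X i.+1 v.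
Proof.
by move=> hi; rewrite -dactZ -!dactM; apply: dact_rel; apply: dr_TXT.
Qed.

Lemma I_X i v : (0 < i < n)%N -> I i (X i v) = q^-1 *: X i.+1 (T i v).
Proof. by move=> hi; rewrite -I_X_I // I_T. Qed.

Lemma T_X i v : (0 < i < n)%N -> T i (X i.+1 v) = q *: X i (I i v).
Proof.
move=> hi; rewrite -[LHS]scale1r -(mulfV q0) -scalerA -[q^-1 *: _]linearZ /= -I_X_I //.
by rewrite T_I.
Qed.

Lemma T_X_comm i j v : (0 < i < n)%N -> (0 < j <= n)%N -> (j != i) -> (j != i.+1) ->
  T i (X j v) = X j (T i v).
Proof. by move=> *; rewrite -!dactM; apply: dact_rel; apply: dr_TX. Qed.

Lemma X_comm i j v : (0 < i <= n)%N -> (0 < j <= n)%N -> X i (X j v) = X j (X i v).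
Proof. by move=> *; rewrite -!dactM; apply: dact_rel; apply: dr_XX. Qed.

Lemma T_Y_T i v : (0 < i < n)%N -> T i (Y i (T i v)) = q *: Y i.+1 v.
Proof. by move=> hi; rewrite -dactZ -!dactM; apply: dact_rel; apply: dr_TYT. Qed.

Lemma YSE i v : (0 < i < n)%N -> Y i.+1 v = q^-1 *: T i (Y i (T i v)).
Proof. by move=> hi; rewrite T_Y_T // scalerA mulVf // scale1r. Qed.

Lemma I_Y i v : (0 < i < n)%N -> I i (Y i.+1 v) = q^-1 *: Y i (T i v).
Proof. by move=> hi; rewrite YSE // linearZ /= I_T. Qed.

Lemma T_Y_comm i j v : (0 < i < n)%N -> (0 < j <= n)%N -> (j != i) -> (j != i.+1) ->
  T i (Y j v) = Y j (T i v).
Proof. by move=> *; rewrite -!dactM; apply: dact_rel; apply: dr_TY. Qed.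

Lemma Y_comm i j v : (0 < i <= n)%N -> (0 < j <= n)%N -> Y i (Y j v) = Y j (Y i v).
Proof. by move=> *; rewrite -!dactM; apply: dact_rel; apply: dr_YY. Qed.

Lemma Y1_T1_X1 v : (1 < n)%N -> Y 1 (T 1 (X 1 v)) = X 2 (Y 1 (T 1 v)).
Proof. by move=> *; rewrite -!dactM; apply: dact_rel; apply: dr_YTX. Qed.

Lemma Y2_X1 v : (1 < n)%N -> Y 2 (X 1 v) = X 1 (I 1 (Y 1 (T 1 v))).
Proof.
by move=> n1; rewrite YSE // Y1_T1_X1 // T_X // scalerA mulVf // scale1r.
Qed.

Local Notation pi := (@dact K q t n V (epi q n)).

Lemma piE v : pi v = q ^- n *: Y 1 (Tup 1 n.-1 v).
Proof. by rewrite !dactE dact_eprod. Qed.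

Lemma pi_Xn v : pi (X n v) = t *: X 1 (pi v).
Proof. by rewrite -!dactM -dactZ; apply: dact_rel; apply: dr_piX. Qed.

Lemma Y1E v : (0 < n)%N -> Y 1 v = q ^+ n *: pi (Idown 1 n.-1 v).
Proof.
move=> n0; rewrite piE scalerA mulfV ?expf_neq0 // scale1r; congr (Y 1 _).
apply: esym; have: (1 + n.-1 <= n)%N by lia.
elim: n.-1 => // m IH hm; rewrite IdownS TupS T_I ?IH //; lia.
Qed.

Lemma pi_T i v : (0 < i)%N -> (i.+1 < n)%N -> pi (T i v) = T i.+1 (pi v).
Proof.
move=> i0 hi; rewrite !piE linearZ /= Tup_up //; try lia.
by rewrite T_Y_comm //; lia.
Qed.

Lemma pi_I i v : (0 < i)%N -> (i.+1 < n)%N -> pi (I i v) = I i.+1 (pi v).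
Proof.
by move=> i0 hi; apply: (@T_inj i.+1); [lia|rewrite -pi_T // !T_I //; lia].
Qed.

(** With [pi_T] and [pi_Xn] this makes pi a rotation of indices, X_n going to t X_1. The case i = 1
    is Y_1 T_1 X_1 = X_2 Y_1 T_1; the others follow from X_(i+1) = q T_i^-1 X_i T_i^-1. *)
Lemma pi_X i v : (0 < i < n)%N -> pi (X i v) = X i.+1 (pi v).
Proof.
elim: i v => // -[_ v /= hn|i IH v hi].
  rewrite !piE linearZ /=; congr (_ *: _).
  have [m em] : {m | n.-1 = m.+1} by exists n.-2; lia.
  rewrite em -[Tup 1 m.+1 (X 1 v)]/(T 1 (Tup 2 m (X 1 v))) -(Tup_comm (B := X 1)).
    by rewrite Y1_T1_X1.
  by move=> j w hj; rewrite T_X_comm //; lia.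
have -> : X i.+2 v = q *: I i.+1 (X i.+1 (I i.+1 v)).
  by rewrite I_X_I; [rewrite scalerA mulfV // scale1r | lia].
rewrite linearZ /= pi_I; [|lia|lia].
rewrite IH ?pi_I; [|lia|lia|lia].
by rewrite I_X_I ?scalerA ?mulfV // scale1r.
Qed.

(** When i < k, T_i turns into T_i^-1 on crossing X_(i+1) and back into T_i on crossing X_i, and the
    powers of q cancel. *)
Lemma T_Xs i k v : (0 < i < n)%N -> (k <= n)%N -> i != k -> T i (Xs k v) = Xs k (T i v).
Proof.
move=> hi; elim: k v => // k IH v hk ik; rewrite !XsS.
have [e|ne] := eqVneq i k; last by rewrite IH ?T_X_comm //; lia.
rewrite -e in hk *; case: i hi {ik e IH} hk => // i hi hk; rewrite !XsS.
have Tc j w : (j <= i)%N -> T i.+1 (Xs j w) = Xs j (T i.+1 w).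
  by elim: j w => // j IH w hj; rewrite !XsS IH ?T_X_comm //; lia.
rewrite Tc //; congr (Xs i _).
rewrite X_comm; [|lia|lia].
by rewrite T_X // I_X // linearZ /= scalerA mulfV // scale1r.
Qed.

Definition Xs2 k u : V := foldr Xw u (iota 2 k).
HB.instance Definition _ k :=
  GRing.isLinear.Build K V V _ (Xs2 k) (foldr_linear _ (iota 2 k)).

Lemma Xs2E k v : X 1 (Xs2 k v) = Xs k.+1 v.
Proof. by []. Qed.

Lemma Xs2S k v : Xs2 k.+1 v = Xs2 k (X k.+2 v).
Proof. by rewrite /Xs2 iota_rcons foldr_rcons. Qed.

Lemma pi_Xs k v : (k < n)%N -> pi (Xs k v) = Xs2 k (pi v).
Proof.
elim: k v => // k IH v hk; rewrite XsS Xs2S IH ?pi_X //; lia.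
Qed.

Lemma Iup_Xs k u : (k < n)%N -> Iup 1 k (Xs k u) = q ^- k *: Xs2 k (Tup 1 k u).
Proof.
elim: k u => [|k IH] u hk; first by rewrite invr1 scale1r.
rewrite IupS XsS; rewrite (I_comm (B := Xs k)); [|lia|by move=> w; rewrite T_Xs //; lia].
rewrite add1n I_X // !linearZ /= IH; last by lia.
rewrite scalerA -invfM -exprS TupS Xs2S; congr (_ *: Xs2 k _).
symmetry; apply: Tup_comm => i w hi; rewrite T_X_comm //; lia.
Qed.

Lemma Idown_X k m u : (0 < k)%N -> (k + m <= n)%N ->
  Idown k m (X k u) = q ^- m *: X (k + m) (Tdown k m u).
Proof.
move=> k0; elim: m => [|m IH] h; first by rewrite addn0 invr1 scale1r.
rewrite IdownS IH ?linearZ /= ?I_X ?scalerA; [|lia|lia].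
by rewrite -invfM -exprSr addnS TdownS.
Qed.

Lemma Idown_Xs a m k v : (0 < a)%N -> (a + m <= n)%N -> (k <= n)%N ->
  (k < a)%N || (a + m <= k)%N -> Idown a m (Xs k v) = Xs k (Idown a m v).
Proof.
move=> a0 am kn ka; symmetry; apply: Idown_comm => // i w hi.
by rewrite T_Xs //; lia.
Qed.

(** In Y_1 = q^n pi T_(n-1)^-1 ... T_1^-1 the letters below k commute with X_1 ... X_k; the others
    commute with X_1 ... X_(k-1) and carry X_k to X_n. Then pi shifts X_1, ..., X_(k-1) and sends
    X_n to t X_1, which restores the product. *)
Lemma Y1_Xs k u : (0 < k <= n)%N ->
  Y 1 (Xs k u) = (t * q ^+ k) *: Xs k (pi (Tdown k (n - k) (Idown 1 k.-1 u))).
Proof.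
case: k => // k hk; rewrite Y1E; last by lia.
rewrite (_ : n.-1 = k + (n - k.+1))%N; last by lia.
have -> : Idown 1 (k + (n - k.+1)) (Xs k.+1 u) =
    Xs k (Idown k.+1 (n - k.+1) (X k.+1 (Idown 1 k u))).
  by rewrite IdownD add1n Idown_Xs ?XsS ?Idown_Xs //; lia.
rewrite Idown_X //; last by lia.
rewrite subnKC // !linearZ /= pi_Xs; last by lia.
rewrite pi_Xn !linearZ /= !scalerA; congr (_ *: _); last first.
  rewrite -Xs2E; symmetry; apply: (@foldr_comm _ Xw (X 1)) => j w.
  by rewrite mem_iota => hj; apply: X_comm; lia.
rewrite -[in q ^+ n](subnK hk) exprD mulrAC mulrC; congr (t * _).
by rewrite mulrAC mulfV ?mul1r // expf_neq0.
Qed.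

(** * The generators of B preserve the spaces L_k(V) *)

Lemma LdpE k v : Ldp k v = q ^+ k *: X 1 (Iup 1 k v).
Proof. by rewrite /Ldp dactM dact_eprod. Qed.

Lemma LdmE k v : (k <= n)%N -> Ldm k v = (q - 1) *: Isum k (n - k) v.
Proof.
move=> kn; rewrite /Ldm /Isum -{1}[k]add0n big_addn subSn // big_mkord; congr (_ *: _).
by apply: eq_bigr => i _; rewrite addnK dact_eprod.
Qed.

Lemma Ldp_linear k : linear (@Ldp K q t n V k).
Proof. by move=> c v w; rewrite /Ldp linearP scalerDr !scalerA [c * _]mulrC. Qed.
HB.instance Definition _ k := GRing.isLinear.Build K V V _ (@Ldp K q t n V k) (Ldp_linear k).

Lemma Ldm_linear k : linear (@Ldm K q t n V k).
Proof.
move=> c v w; rewrite /Ldm scalerA [c * _]mulrC -scalerA -scalerDr; congr (_ *: _).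
rewrite scaler_sumr -big_split; apply: eq_bigr => i _ /=.
by rewrite linearP scalerDr !scalerA [c * _]mulrC.
Qed.
HB.instance Definition _ k := GRing.isLinear.Build K V V _ (@Ldm K q t n V k) (Ldm_linear k).

Lemma Ldelem_invariant k v : (k <= n)%N -> Ldelem k v -> young_invariant k v.
Proof. by move=> kn [u hu ->] j hj; rewrite T_Xs ?hu //; lia. Qed.

Lemma Ldelem_T k i v : (k <= n)%N -> (0 < i < k)%N -> Ldelem k v -> Ldelem k (T i v).
Proof.
move=> kn ik [u hu ->]; exists (T i u); last by rewrite T_Xs //; lia.
by move=> j hj; rewrite T_comm ?(hu j) //; lia.
Qed.

Lemma young_invariantZ k (c : K) u : young_invariant k u -> young_invariant k (c *: u).
Proof. by move=> h j hj; rewrite linearZ /= h. Qed.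

Lemma LdelemZ k (c : K) v : Ldelem k v -> Ldelem k (c *: v).
Proof.
by move=> [u hu ->]; exists (c *: u); [apply: young_invariantZ | rewrite linearZ].
Qed.

Lemma Ldelem_Y k i v : (k <= n)%N -> (0 < i <= k)%N -> Ldelem k v -> Ldelem k (Y i v).
Proof.
move=> kn; elim: i v => // -[_ v hi [u hu ->]|i IH v hi hv]; last first.
  rewrite YSE; last by lia.
  have hk : (0 < i.+1 < k)%N by lia.
  by apply/LdelemZ/(Ldelem_T kn hk)/IH; [lia | apply: Ldelem_T].
rewrite Y1_Xs; last by lia.
apply: LdelemZ; eexists; last by [].
(* Crossing pi lowers the index j + 1 to j and crossing T_(n-1) ... T_k raises it again, so T_(j+1)
   reaches u. *)
case=> // j hj; rewrite -pi_T; [|lia|lia].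
rewrite -Tdown_down; [|lia|lia|lia|lia].
rewrite (Idown_comm (B := T j.+1)); [|lia|lia|by move=> l w hl; rewrite T_comm //; lia].
by rewrite hu.
Qed.

(** By [Iup_Xs], d_+ sends X_1 ... X_k u to X_1 ... X_(k+1) T_1 ... T_k u. *)
Lemma Ldelem_dp k v : (k < n)%N -> Ldelem k v -> Ldelem k.+1 (Ldp k v).
Proof.
move=> kn [u hu ->]; rewrite LdpE Iup_Xs // linearZ /= Xs2E scalerA mulfV ?expf_neq0 //.
rewrite scale1r; eexists; last by [].
move=> j hj; rewrite (Tup_comm (B := T j)) ?hu //; first by lia.
by move=> i w hi; rewrite T_comm //; lia.
Qed.

Lemma Ldelem_dm k v : (k < n)%N -> Ldelem k.+1 v -> Ldelem k (Ldm k.+1 v).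
Proof.
move=> kn [u hu ->]; rewrite LdmE //; apply: LdelemZ.
rewrite XsS -(Isum_comm (B := Xs k)); [|lia|lia|by move=> i w hi; rewrite T_Xs //; lia].
eexists; last by []; apply: (@Isum_invariant k.+1) => // j hj.
by rewrite T_X_comm ?hu //; lia.
Qed.

(** * Relations between the generators *)

Lemma Idown_Idown a p r v : (0 < a)%N -> (a + p <= n)%N -> (r < p)%N ->
  Idown a p (Idown a.+1 r v) = Idown a r (Idown a p v).
Proof.
move=> a0 ap; elim: r => // r IH rp; rewrite !IdownS addSn Idown_down ?IH //; lia.
Qed.

(* The increments in m of the double sum depend on v only through             *)
(* v + q T_a^-1 v, which does not change when v is replaced by T_a v.         *)
Lemma Isum_Isum_T a m v : (0 < a)%N -> (a + m.+1 <= n)%N ->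
  Isum a m.+1 (Isum a.+1 m (T a v)) = Isum a m.+1 (Isum a.+1 m v).
Proof.
move=> a0 h; have ha : (0 < a < n)%N by lia.
have Ta : T a v + q *: I a (T a v) = v + q *: I a v.
  by rewrite I_T // TE scalerBl scale1r -addrA subrK addrC.
elim: m h => [|m IH] h; first by rewrite !IsumSl !Isum0.
have E w : Isum a m.+2 (Isum a.+1 m.+1 w) = Isum a m.+1 (Isum a.+1 m w) +
    q ^+ m.+1 *: Isum a m.+1 (Idown a.+1 m.+1 (w + q *: I a w)).
  have -> : Isum a m.+2 (Isum a.+1 m.+1 w) = Isum a m.+1 (Isum a.+1 m.+1 w) +
      q ^+ m.+2 *: Isum a m.+1 (Idown a m.+2 w).
    rewrite IsumS; congr (_ + _ *: _); rewrite /Isum linear_sum.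
    apply: eq_bigr => -[r /= hr] _; rewrite linearZ /= Idown_Idown //; lia.
  rewrite [Isum a.+1 m.+1 w]IsumS linearD linearZ /= -addrA; congr (_ + _).
  rewrite (IdownSr a) [q ^+ m.+2]exprSr -scalerA -scalerDr; congr (_ *: _).
  by rewrite !linearD !linearZ.
by rewrite !E Ta IH //; lia.
Qed.

Lemma Ldm_Ldm_T k v : (k.+2 <= n)%N ->
  Ldm k.+1 (Ldm k.+2 (T k.+1 v)) = Ldm k.+1 (Ldm k.+2 v).
Proof.
move=> kn; have kn' := ltnW kn; rewrite !LdmE //.
by rewrite !linearZ /= -(subnSK kn) Isum_Isum_T //; lia.
Qed.

Lemma Ldm_T k i v : (k <= n)%N -> (0 < i)%N -> (i.+1 < k)%N ->
  Ldm k (T i v) = T i (Ldm k v).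
Proof.
move=> kn i0 ik; rewrite !LdmE // [RHS]linearZ /= (Isum_comm (B := T i)) //; try lia.
by move=> j w hj; rewrite T_comm //; lia.
Qed.

Lemma Ldm_Y k i v : (k <= n)%N -> (0 < i < k)%N -> Ldm k (Y i v) = Y i (Ldm k v).
Proof.
move=> kn ik; rewrite !LdmE // [RHS]linearZ /= (Isum_comm (B := Y i)) //; try lia.
by move=> j w hj; rewrite T_Y_comm //; lia.
Qed.

Lemma Ldp_T k i v : (k < n)%N -> (0 < i < k)%N -> Ldp k (T i v) = T i.+1 (Ldp k v).
Proof.
move=> kn ik; rewrite !LdpE linearZ /= Iup_upT ?T_X_comm //; lia.
Qed.

(** For i = 1, Y_2 X_1 = X_1 T_1^-1 Y_1 T_1, whose T_1 cancels the first letter of T_1^-1 ...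
    T_k^-1. Larger i follow from [Ldp_T] through [YSE]. *)
Lemma Ldp_Y k i v : (k < n)%N -> (0 < i <= k)%N -> Ldp k (Y i v) = Y i.+1 (Ldp k v).
Proof.
move=> kn; elim: i v => // -[_ v hk|i IH v hi].
  rewrite !LdpE linearZ /= Y2_X1; last by lia.
  case: k kn hk => // k kn _; rewrite /Iup /=.
  rewrite T_I; last by lia.
  rewrite -!/(Iup _ _ _) (Iup_comm (B := Y 1)) //; try lia.
  by move=> j w hj; rewrite T_Y_comm //; lia.
have h1 : (0 < i.+1 < n)%N by lia.
have h2 : (0 < i.+1 < k)%N by lia.
have h3 : (0 < i.+2 < n)%N by lia.
rewrite (YSE v h1) (YSE (Ldp k v) h3) -(Ldp_T v kn h2).
rewrite -IH; last by lia.
by rewrite -Ldp_T //; exact: linearZ.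
Qed.

(** Both d_+^2 and d_+ phi have this form with l = k - 1, and phi d_+ has it with l = k, since phi
    acts by the formula of d_+ with the index lowered by one. *)
Lemma Ldp_Ldp k l v : (0 < k < n)%N ->
  Ldp k (Ldp l v) = (q ^+ (k + l) / q) *: X 1 (X 2 (T 1 (Iup 2 k.-1 (Iup 1 l v)))).
Proof.
case: k => // k kn; rewrite !LdpE !linearZ /= scalerA -exprD.
rewrite -[Iup 1 k.+1 _]/(I 1 (Iup 2 k _)) -(Iup_comm (B := X 1)); [|lia|lia|].
  rewrite I_X; last by lia.
  by rewrite linearZ /= scalerA addnC.
by move=> j w hj; rewrite T_X_comm //; lia.
Qed.

Lemma T1_X1_X2 v : (1 < n)%N -> T 1 (X 1 (X 2 v)) = X 1 (X 2 (T 1 v)).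
Proof. by move=> hn; apply: (@T_Xs 1 2). Qed.

Lemma Iup_Iup a p r v : (0 < a)%N -> (a + p <= n)%N -> (r < p)%N ->
  Iup a p (Iup a r v) = Iup a.+1 r (Iup a p v).
Proof.
move=> a0 ap; elim: r v => // r IH v rp; rewrite !IupS IH; last by lia.
by rewrite Iup_up //; lia.
Qed.

Lemma Iup_Iup1 k v : (k.+1 < n)%N ->
  Iup 2 k (Iup 1 k.+1 v) = I 1 (Iup 2 k (Iup 1 k v)).
Proof. by move=> kn; rewrite -Iup_Iup. Qed.

Lemma T1_Ldp_Ldp k v : (k.+1 < n)%N -> young_invariant k v ->
  T 1 (Ldp k.+1 (Ldp k v)) = Ldp k.+1 (Ldp k v).
Proof.
move=> kn hv; have n1 : (1 < n)%N by lia.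
rewrite Ldp_Ldp // linearZ /= T1_X1_X2 //; congr (_ *: X 1 (X 2 (T 1 _))).
rewrite -[RHS](@T_I 1) // -Iup_Iup1 // IupS (young_invariant_I hv) //.
by lia.
Qed.

Lemma T1_phi_Ldp k v : (k.+1 < n)%N ->
  T 1 (Ldp k.+1 (Ldp k.+1 v)) = q *: Ldp k.+1 (Ldp k v).
Proof.
move=> kn; have n1 : (1 < n)%N by lia.
rewrite !Ldp_Ldp // linearZ /= T1_X1_X2 // Iup_Iup1 // T_I // scalerA addnS exprS.
by rewrite [q * _]mulrC mulfK // mulrC divfK.
Qed.

(* On L_(k+1)(V) the operator phi is given by the formula of d_+ on L_k(V).   *)
Lemma phi_Ldp k v : (k.+1 < n)%N ->
  Ldp k (Ldm k.+1 v) - Ldm k.+2 (Ldp k.+1 v) = (q - 1) *: Ldp k v.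
Proof.
move=> kn; rewrite !LdmE //; last by lia.
rewrite linearZ /= -scalerBr; congr (_ *: _).
(* The first summand of d_- gives the right-hand side. The others cancel against d_- d_+: the
   letters of d_- on L_(k+2) commute with X_1 and T_1^-1 ... T_k^-1, and T_(k+1)^-1 is split off on
   both sides. *)
rewrite -(subnSK kn) IsumSl [LHS]/= linearD /= -addrA -[RHS]addr0; congr (_ + _).
apply/eqP; rewrite subr_eq0 !LdpE IupS add1n; apply/eqP.
rewrite linearZ /= [RHS]linearZ /= exprSr -scalerA; congr (_ *: _).
rewrite [LHS]linearZ /= ; congr (_ *: _).
rewrite -(Isum_comm (B := X 1)) ?(Isum_comm (B := Iup 1 k)) //; try lia.
  move=> j w hj; symmetry; rewrite (Iup_comm (B := T j)) //; first by lia.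
  by move=> l z hl; rewrite T_comm //; lia.
by move=> j w hj; rewrite T_X_comm //; lia.
Qed.

(** T_(k+1) cancels the last letter of phi; the remaining letters are far enough from those of d_-
    to commute with them. *)
Lemma phi_Ldm k v : (k.+1 < n)%N ->
  q *: Ldp k (Ldm k.+2 v) = Ldm k.+2 (Ldp k.+1 (T k.+1 v)).
Proof.
move=> kn; rewrite !LdpE !LdmE // IupS add1n I_T // !linearZ /= !scalerA.
congr (_ *: _); first by rewrite exprS; ring.
rewrite (Isum_comm (B := Iup 1 k)) ?(Isum_comm (B := X 1)) //; try lia.
  by move=> j w hj; rewrite T_X_comm //; lia.
move=> j w hj; symmetry; rewrite (Iup_comm (B := T j)) //; first by lia.
by move=> l z hl; rewrite T_comm //; lia.
Qed.

Lemma Iup_Y k v : (k < n)%N -> Iup 1 k (Y k.+1 v) = q ^- k *: Y 1 (Tup 1 k v).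
Proof.
elim: k v => [|k IH] v kn; first by rewrite invr1 scale1r.
rewrite IupS add1n I_Y // linearZ /= IH; last by lia.
by rewrite scalerA -invfM -exprS TupS.
Qed.

(** This is the relation between z_1 and z_k at vertex k + 1, up to scalars: the argument of [Ldp]
    on the left is d_- v + v. *)
Lemma Y1_Ldp k v : (k < n)%N -> young_invariant k.+1 v ->
  Y 1 (Ldp k ((q - 1) *: Isum k.+1 (n - k.+1) v + v)) = (q * t) *: Ldp k (Y k.+1 v).
Proof.
move=> kn hv; set x := _ + v.
(* The T_j with j > k fix d_- v, which cancels the term -d_- v that [Tdown_Isum] produces from v. *)
have key : Tdown k.+1 (n - k.+1) x = q ^+ (n - k) *: Idown k.+1 (n - k.+1) v.
  rewrite /x linearD linearZ /=.
  have -> : Tdown k.+1 (n - k.+1) (Isum k.+1 (n - k.+1) v) = Isum k.+1 (n - k.+1) v.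
    have := @Isum_invariant k.+1 v kn hv; set y := Isum _ _ _; move=> /= hy.
    have h m : (k.+1 + m <= n)%N -> Tdown k.+1 m y = y; last by apply: h; lia.
    by elim: m => // m IH hm; rewrite TdownS IH ?hy //; lia.
  by rewrite Tdown_Isum ?subnKC // addrC subrK subnSK.
rewrite !LdpE !linearZ /= -[X 1 _]/(Xs 1 _) Y1_Xs; last by lia.
rewrite Iup_Y // /= !linearZ /= Y1E; last by lia.
rewrite (_ : n.-1 = k + (n - k.+1))%N; last by lia.
rewrite IdownD Idown_Tup //; try lia.
rewrite (_ : n - 1 = k + (n - k.+1))%N; last by lia.
rewrite TdownD Tdown_Iup //; try lia.
rewrite add1n key !linearZ /= !scalerA; congr (_ *: _).
rewrite -{2}(subnK (ltnW kn)) exprD expr1.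
have := expf_neq0 k q0; move: (q ^+ k) (q ^+ (n - k)) => a b a0.
by field.
Qed.

(** * The action of B^(n) on the sum of the L_k(V) *)

Lemma singleE k (v : V) : single k v k = v.
Proof. by rewrite /single eqxx. Qed.

Lemma single_neq j k (v : V) : j != k -> single k v j = 0.
Proof. by rewrite /single => /negbTE ->. Qed.

Lemma single0 k : single k (0 : V) = fun=> 0.
Proof. by apply/funext => j; rewrite /single if_same. Qed.

Definition seq_add (f g : nat -> V) : nat -> V := fun j => f j + g j.
Definition seq_opp (f : nat -> V) : nat -> V := fun j => - f j.
Definition seq_scale (c : K) (f : nat -> V) : nat -> V := fun j => c *: f j.

Lemma singleD k (v w : V) : seq_add (single k v) (single k w) = single k (v + w).
Proof. by apply/funext => j; rewrite /seq_add /single; case: eqP; rewrite ?addr0. Qed.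

Lemma singleN k (v : V) : seq_opp (single k v) = single k (- v).
Proof. by apply/funext => j; rewrite /seq_opp /single; case: eqP; rewrite ?oppr0. Qed.

Lemma singleZ k (c : K) (v : V) : seq_scale c (single k v) = single k (c *: v).
Proof. by apply/funext => j; rewrite /seq_scale /single; case: eqP; rewrite ?scaler0. Qed.

Lemma dactZr e (c : K) v : dact e (c *: v) = c *: dact e v.
Proof. exact: linearZ. Qed.

Lemma LdpZ k (c : K) v : Ldp k (c *: v) = c *: Ldp k v.
Proof. exact: linearZ. Qed.

Lemma LdmZ k (c : K) v : Ldm k (c *: v) = c *: Ldm k v.
Proof. exact: linearZ. Qed.

Implicit Types (y : nat -> V) (a b : expr K false bgen).

Lemma LactM a b y : Lact (a * b)%X y = Lact a (Lact b y). Proof. by []. Qed.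
Lemma LactD a b y : Lact (a + b)%X y = seq_add (Lact a y) (Lact b y).
Proof. by []. Qed.
Lemma LactN a y : Lact (EOpp a) y = seq_opp (Lact a y). Proof. by []. Qed.
Lemma LactZ c a y : Lact (c *: a)%X y = seq_scale c (Lact a y). Proof. by []. Qed.
Lemma Lact0 y : Lact 0%X y = fun=> 0. Proof. by []. Qed.
Lemma Lact_be k y : Lact (be K k) y = single k (y k). Proof. by []. Qed.
Lemma Lact_bdp k y : Lact (bdp K k) y = single k.+1 (Ldp k (y k)). Proof. by []. Qed.
Lemma Lact_bdm k y : Lact (bdm K k.+1) y = single k (Ldm k.+1 (y k.+1)).
Proof. by []. Qed.
Lemma Lact_bT k i y : (0 < i < k)%N -> Lact (bT K k i) y = single k (T i (y k)).
Proof. by move=> hi; rewrite /bT insubT. Qed.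
Lemma Lact_bz k i y : (0 < i <= k)%N ->
  Lact (bz K k i) y = single k ((q * t)^-1 *: Y i (y k)).
Proof. by move=> hi; rewrite /bz insubT. Qed.
Lemma Lact_bTV k i y : (0 < i < k)%N -> Lact (bTV q k i) y = single k (I i (y k)).
Proof.
by move=> hi; rewrite /bTV LactZ LactD LactZ Lact_bT // Lact_be singleZ singleD singleZ IE.
Qed.
Lemma upto_bT N k i : (0 < i < k)%N -> bexpr_upto N (bT K k i) = (k <= N)%N.
Proof. by move=> hi; rewrite /bT insubT. Qed.
Lemma upto_bz N k i : (0 < i <= k)%N -> bexpr_upto N (bz K k i) = (k <= N)%N.
Proof. by move=> hi; rewrite /bz insubT. Qed.

Definition LactE := (LactM, LactD, LactN, LactZ, Lact0, Lact_be, Lact_bdp, Lact_bdm,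
  singleE, singleD, singleN, singleZ).

Lemma Lact_bphi k y : (k.+1 < n)%N -> Lact (bphi q k.+1) y = single k.+1 (Ldp k (y k.+1)).
Proof.
move=> kn; rewrite /bphi !LactE [k.+1.-1]/= phi_Ldp //.
by rewrite scalerA mulVf ?transcendental_neq1 // scale1r.
Qed.

Hypothesis t0 : t != 0.
Let qt0 : q * t != 0. Proof. by rewrite mulf_neq0. Qed.

Local Arguments Lact : simpl never.

(** The bounds on a and b keep all paths within the vertices 0, ..., n. Membership in the L_k enters
    as invariance, in T_1 d_+^2 = d_+^2 and in the relation of z_1 with z_k. *)
Lemma Lact_rel a b y : brel q t a b -> bexpr_upto n a -> bexpr_upto n b ->
  (forall k, (k <= n)%N -> Lspace V k (y k)) -> Lact a y = Lact b y.
Proof.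
move=> r ha hb hy.
have {hy} inv k : (k <= n)%N -> young_invariant k (y k).
  by move=> kn; apply: Ldelem_invariant => //; apply/LspaceP/hy.
case: r ha hb => {a b}.
- by move=> k _ _; rewrite !LactE.
- by move=> j k jk _ _; rewrite !LactE single_neq // single0.
- by move=> k i hi _ _; rewrite LactE Lact_bT // !LactE.
- by move=> k i hi _ _; rewrite LactE !Lact_bT // !LactE.
- by move=> k i hi _ _; rewrite LactE Lact_bz // !LactE.
- by move=> k i hi _ _; rewrite LactE !Lact_bz // !LactE.
- by move=> k _ _; rewrite !LactE.
- by move=> k _ _; rewrite !LactE.
- by case=> // k _ _ _; rewrite !LactE.
- by case=> // k _ _ _; rewrite !LactE.
- move=> k i hi /=; rewrite upto_bT // => /andP[/andP[/= kn _] _] _.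
  have hi' : (0 < i < n)%N by lia.
  rewrite !LactE !Lact_bT // !LactE linearD linearZ /= T_quad //.
  apply: etrans (single0 k); congr (single k _).
  by apply/eqP; rewrite subr_eq0 addrAC -scalerDl subrK scale1r.
- move=> k i i0 ik; rewrite /= !upto_bT //; try lia; move=> /andP[/andP[/= kn _] _] _.
  rewrite !LactE !(Lact_bT, LactE) //; try lia.
  by rewrite T_braid //; lia.
- move=> k i j hi hj ij; rewrite /= !upto_bT // => /andP[/= kn _] _.
  rewrite !LactE !(Lact_bT, LactE) //; rewrite T_comm //; lia.
- move=> k i hi; rewrite /= !upto_bT ?upto_bz //; try lia.
  move=> /andP[/andP[/andP[/= kn _] _] _] _.
  rewrite !LactM !(Lact_bTV, Lact_bz, singleE) //; try lia.
  rewrite LactZ Lact_bz ?singleZ; last by lia.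
  have hi' : (0 < i < n)%N by lia.
  by rewrite dactZr I_Y // T_I // !scalerA mulrC.
- move=> k i j hi hj ij ij1; rewrite /= !upto_bT ?upto_bz // => /andP[/= kn _] _.
  rewrite !LactE !(Lact_bT, Lact_bz, LactE) // dactZr T_Y_comm //; lia.
- move=> k i j hi hj; rewrite /= !upto_bz // => /andP[/= kn _] _.
  rewrite !LactE !(Lact_bz, LactE) // !dactZr Y_comm //; lia.
- case=> [|[|k]] //= _ /andP[/andP[_ kn] _] _.
  by rewrite !LactE Lact_bT ?LactE ?Ldm_Ldm_T //; lia.
- case=> // k i i0 ik /= /andP[/= kn _] _.
  rewrite !LactE !(Lact_bT, LactE) //; try lia.
  by rewrite Ldm_T //; lia.
- move=> k /= /andP[/andP[_ k1] k2] _.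
  rewrite !LactE Lact_bT // !LactE T1_Ldp_Ldp //; apply: inv; lia.
- move=> k i hi /= /andP[k1 _] _.
  rewrite !LactE !(Lact_bT, LactE) //; try lia.
  by rewrite Ldp_T //; lia.
- case=> [|[|k]] // _ _ /andP[/andP[_ /andP[_ /andP[/= kn _]]] _].
  rewrite LactZ !LactM !Lact_bphi; [|lia|lia].
  rewrite !(Lact_bdm, Lact_bT, singleE, singleZ) //; try lia.
  by rewrite phi_Ldm //; lia.
- case=> // k _ /andP[/andP[_ /andP[_ /andP[/= kn _]]] _] _.
  rewrite LactZ !LactM !Lact_bphi; [|lia|lia].
  rewrite !(Lact_bdp, Lact_bT, singleE, singleZ) //; try lia.
  by rewrite T1_phi_Ldp //; lia.
- case=> // k i hi; rewrite /= !upto_bz; try lia; move=> /andP[_ kn] _.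
  rewrite !LactM Lact_bdm !Lact_bz ?Lact_bdm ?singleE; try lia.
  by rewrite LdmZ Ldm_Y //; lia.
- move=> k i hi; rewrite /= !upto_bz; try lia; move=> /andP[/= kn _] _.
  rewrite !LactM !Lact_bdp !Lact_bz ?singleE; try lia.
  by rewrite LdpZ Ldp_Y //; lia.
case=> // k hk /andP[_ /andP[_ /andP[/= kn _]]] _.
rewrite !LactM LactZ LactM !LactD !LactN LactZ !LactM !Lact_bdp !Lact_bdm !singleE.
have hk1 : (0 < k.+1 <= k.+1)%N by lia.
rewrite !Lact_bz // !(singleZ, singleN, singleD, singleE); congr (single _ _).
set w := y k.+1; have hw : young_invariant k.+1 w by apply: inv; lia.
rewrite phi_Ldp //.
(* Write q d_+ d_- - d_- d_+ as (q - 1) d_+ d_- plus the commutator, which is (q - 1) phi. *)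
have -> : q *: Ldp k (Ldm k.+1 w) - Ldm k.+2 (Ldp k.+1 w) =
    (q - 1) *: Ldp k ((q - 1) *: Isum k.+1 (n - k.+1) w + w).
  rewrite -LdmE; last by lia.
  rewrite linearD scalerDr -(phi_Ldp w kn) addrA; congr (_ - _).
  by rewrite scalerBl scale1r subrK.
rewrite dactZr Y1_Ldp ?LdpZ //; last by lia.
rewrite !scalerA; congr (_ * _ *: _).
by rewrite mulrCA mulVf // mulr1 mulrAC mulfV // mul1r.
Qed.

End DAHAModule.

(** * Stable limits *)

Section CompatibleMaps.
Variables (K : fieldType) (q t : K) (C : compseq q t).
Hypothesis hq : transcendental q.
Variable n : nat.
Hypothesis hn : (cs_start C <= n)%N.
Local Notation Pi := (cs_map C n).
Implicit Types (v u : C n.+1).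

Lemma map_I i v : (0 < i < n)%N ->
  Pi (dact (eTV q n.+1 i) v) = dact (eTV q n i) (Pi v).
Proof. by move=> hi; rewrite !IE linearZ linearD linearZ /= cs_mapT. Qed.

Lemma map_foldr (f : nat -> expr K true (dgen n.+1)) (g : nat -> expr K true (dgen n)) s v :
  (forall i w, i \in s -> Pi (dact (f i) w) = dact (g i) (Pi w)) ->
  Pi (foldr (fun i => dact (f i)) v s) = foldr (fun i => dact (g i)) (Pi v) s.
Proof.
elim: s => //= i s IH h; rewrite h ?mem_head // IH // => j w js.
by apply: h; rewrite inE js orbT.
Qed.

Lemma map_Iup a m v : (0 < a)%N -> (a + m <= n)%N -> Pi (Iup a m v) = Iup a m (Pi v).
Proof.
by move=> a0 am; apply: map_foldr => i w; rewrite mem_iota => hi; apply: map_I; lia.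
Qed.

Lemma map_Idown a m v : (0 < a)%N -> (a + m <= n)%N ->
  Pi (Idown a m v) = Idown a m (Pi v).
Proof.
move=> a0 am; apply: map_foldr => i w; rewrite mem_rev mem_iota => hi.
by apply: map_I; lia.
Qed.

Lemma map_Tdown a m v : (0 < a)%N -> (a + m <= n)%N ->
  Pi (Tdown a m v) = Tdown a m (Pi v).
Proof.
move=> a0 am; apply: map_foldr => i w; rewrite mem_rev mem_iota => hi.
by apply: cs_mapT; lia.
Qed.

Lemma map_Isum a m v : (0 < a)%N -> (a + m <= n)%N ->
  Pi (Isum a m v) = Isum a m (Pi v).
Proof.
move=> a0 am; rewrite /Isum linear_sum; apply: eq_bigr => -[l /= hl] _.
by rewrite linearZ /= map_Idown //; lia.
Qed.

Lemma map_Xs k v : (k <= n)%N -> Pi (Xs k v) = Xs k (Pi v).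
Proof.
by move=> kn; apply: map_foldr => i w; rewrite mem_iota => hi; apply: cs_mapX; lia.
Qed.

Lemma map_invariant k u : young_invariant k u -> young_invariant k (Pi u).
Proof. by move=> h j hj; rewrite -cs_mapT ?h //; lia. Qed.

Lemma map_Lspace k v : (k <= n)%N -> Lspace (C n.+1) k v -> Lspace (C n) k (Pi v).
Proof.
move=> kn /(LspaceP hq) [u hu ->]; apply/(LspaceP hq); exists (Pi u).
  exact: map_invariant.
exact: map_Xs.
Qed.

Lemma map_Ldp k v : (k < n)%N -> Pi (Ldp k v) = Ldp k (Pi v).
Proof.
by move=> kn; rewrite !LdpE linearZ /= cs_mapX ?map_Iup //; lia.
Qed.

(** The additional summand T_n^-1 ... T_k^-1 of d_- at n + 1 carries X_k to X_(n+1), and Pi X_(n+1)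
    = 0. *)
Lemma map_Ldm k v : (0 < k <= n)%N -> Lspace (C n.+1) k v -> Pi (Ldm k v) = Ldm k (Pi v).
Proof.
case: k => // k /= kn /(LspaceP hq) [u hu ->].
rewrite !LdmE //; last by lia.
rewrite linearZ /=; congr (_ *: _).
rewrite subSn // IsumS linearD /= map_Isum //; last by lia.
rewrite XsS (Idown_Xs hq) ?(Idown_X hq) //; try lia.
rewrite !linearZ /= !map_Xs ?(ltnW kn) // addnS subnKC // cs_mapX0 //.
by rewrite linear0 !scaler0 addr0.
Qed.

(** For i = 1, the formula of [Y1_Xs] at n + 1 contains pi T_n, to which the compatibility condition
    applies; the scalar t q^k does not depend on n. *)
Lemma map_Y k i v : (0 < i <= k)%N -> (k <= n)%N -> Lspace (C n.+1) k v ->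
  Pi (dact (eY K n.+1 i) v) = dact (eY K n i) (Pi v).
Proof.
move=> hi kn /(LspaceP hq); elim: i hi v => // -[_ hi v [u hu ->]|i IH hi v hv].
  rewrite (Y1_Xs hq) ?map_Xs ?(Y1_Xs hq) //; try lia.
  rewrite linearZ /= map_Xs //; congr (_ *: Xs k _).
  rewrite subSn // TdownS subnKC // -dactM cs_map_pi // map_Tdown; [|lia|lia].
  by rewrite map_Idown //; lia.
have h1 : (0 < i.+1 < n.+1)%N by lia.
have h2 : (0 < i.+1 < n)%N by lia.
have h3 : (0 < i.+1 < k)%N by lia.
rewrite (YSE hq v h1) (YSE hq (Pi v) h2) linearZ; congr (_ *: _).
have hT : Ldelem k (dact (eT K n.+1 i.+1) v) by apply: (Ldelem_T hq) => //; lia.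
rewrite cs_mapT // IH //; last by lia.
by rewrite cs_mapT.
Qed.

(* [y'] only has to agree with the image of [y] at the vertices 0, ..., n.    *)
Lemma map_Lgen g (y : nat -> C n.+1) (y' : nat -> C n) k :
  bgen_upto n g -> (forall j, (j <= n)%N -> Lspace (C n.+1) j (y j)) ->
  (forall j, (j <= n)%N -> Pi (y j) = y' j) ->
  Pi (Lgen g y k) = Lgen g y' k.
Proof.
have hsingle j (v : C n.+1) w : Pi v = w -> Pi (single j v k) = single j w k.
  by move=> <-; rewrite /single; case: eqP; rewrite ?linear0.
move=> hg hy e; case: g hg => [j|j [i hi]|j [i hi]|j|j] jn; apply: hsingle.
- exact: e.
- by rewrite -(e _ jn) cs_mapT //=; move: jn => /=; lia.
- by rewrite -(e _ jn) linearZ /= (@map_Y j) //; apply: hy.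
- by rewrite -(e _ (ltnW jn)) map_Ldp.
- by rewrite -(e _ jn) map_Ldm //; apply: hy.
Qed.

End CompatibleMaps.

(** * Images and degrees under a single generator *)

Section GeneratorAction.
Variables (K : fieldType) (q t : K) (n : nat) (V : gmod (DAHA q t n)).
Hypothesis hq : transcendental q.
Implicit Types (y : nat -> V) (g : bgen).

Lemma Lspace0 k : Lspace V k 0.
Proof. by exists 0; rewrite ga_act0. Qed.

Lemma Lgen_Lspace g y : bgen_upto n g -> (forall k, (k <= n)%N -> Lspace V k (y k)) ->
  forall k, Lspace V k (Lgen g y k).
Proof.
move=> hg hy k; have hsingle j v : Lspace V j v -> Lspace V k (single j v k).
  by rewrite /single; case: eqP => [->|_] // _; exact: Lspace0.
case: g hg => /= [j|j [i hi]|j [i hi]|j|j] jn; apply: hsingle.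
- exact: hy.
- by apply/(LspaceP hq); apply: (Ldelem_T hq) => //; apply/(LspaceP hq)/hy.
- by apply/(LspaceP hq)/LdelemZ; apply: (Ldelem_Y hq) => //; apply/(LspaceP hq)/hy.
- by apply/(LspaceP hq); apply: (Ldelem_dp hq) => //; apply/(LspaceP hq)/hy/ltnW.
- by apply/(LspaceP hq); apply: (Ldelem_dm hq) => //; apply/(LspaceP hq)/hy.
Qed.

Lemma Lgen_above N g y k : bgen_upto N g -> (N < k)%N -> Lgen g y k = 0.
Proof. by case: g => /= *; rewrite single_neq //; lia. Qed.

Lemma gcompZ d (c : K) (v : V) : gcomp d v -> gcomp d (c *: v).
Proof. by move=> h; rewrite -[_ *: _]addr0; apply: gcompP => //; apply: gcomp0. Qed.

Lemma gcomp_dact c d e (v : V) : ehomog (P := DAHA q t n) c e -> gcomp d v ->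
  gcomp (c + d) (dact e v).
Proof. exact: ga_deg. Qed.

Lemma ehomog_eprod (f : nat -> expr K true (dgen n)) s :
  (forall i, ehomog (P := DAHA q t n) 0 (f i)) ->
  ehomog (P := DAHA q t n) 0 (eprod f s).
Proof.
move=> h; elim: s => [|i s IH] /=; first exact: eh_one.
exact: (eh_mul (h i) IH).
Qed.

Lemma ehomog_eT i : ehomog (P := DAHA q t n) 0 (eT K n i).
Proof.
by rewrite /eT; case: insub => [j|]; [exact: (@eh_gen K (DAHA q t n) (DT j))|exact: eh_zero].
Qed.

Lemma ehomog_eY i : ehomog (P := DAHA q t n) 0 (eY K n i).
Proof.
by rewrite /eY; case: insub => [j|]; [exact: (@eh_gen K (DAHA q t n) (DY j))|exact: eh_zero].
Qed.

Lemma ehomog_eX i : ehomog (P := DAHA q t n) 1 (eX K n i).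
Proof.
by rewrite /eX; case: insub => [j|]; [exact: (@eh_gen K (DAHA q t n) (DX j))|exact: eh_zero].
Qed.

Lemma ehomog_eTV i : ehomog (P := DAHA q t n) 0 (eTV q n i).
Proof.
apply/eh_scale/eh_add; first exact: ehomog_eT.
by apply: eh_scale; exact: eh_one.
Qed.

Lemma Lgen_deg g y d : (forall k, (k <= n)%N -> gcomp d (y k)) -> bgen_upto n g ->
  forall k, gcomp (bdeg g + d) (Lgen g y k).
Proof.
move=> hy hg k; have hsingle j v e : gcomp e v -> gcomp e (single j v k).
  by rewrite /single; case: eqP => // _ _; exact: gcomp0.
case: g hg => /= [j|j [i hi]|j [i hi]|j|j] jn; apply: hsingle.
- exact: hy.
- by apply: gcomp_dact (hy _ jn); apply: ehomog_eT.
- by apply/gcompZ; apply: gcomp_dact (hy _ jn); apply: ehomog_eY.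
- apply/gcompZ; apply: gcomp_dact (hy _ (ltnW jn)).
  by rewrite -[1%N]addn0; apply: eh_mul (ehomog_eX _) (ehomog_eprod _ ehomog_eTV).
- apply/gcompZ; elim/big_ind: _ => [|v w hv hw|i _]; first exact: gcomp0.
    by rewrite -[v]scale1r; apply: gcompP.
  by apply/gcompZ; apply: gcomp_dact (hy _ jn); apply: ehomog_eprod ehomog_eTV.
Qed.

Lemma Lgen_linear g (c : K) y y' k :
  Lgen g (fun j => c *: y j + y' j) k = c *: Lgen g y k + Lgen g y' k.
Proof.
have hsingle j (v w z : V) : z = c *: v + w ->
    single j z k = c *: single j v k + single j w k.
  by move=> ->; rewrite /single; case: eqP; rewrite ?scaler0 ?addr0.
case: g => [j|j i|j i|j|j]; apply: hsingle; rewrite ?linearP //.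
Qed.

End GeneratorAction.

(** * Tails of stable sequences *)

Section StableExtension.
Variables (K : fieldType) (q t : K) (C : compseq q t).
Hypothesis hq : transcendental q.
Implicit Types (v w : cs_seq C) (k d M n : nat).

Definition lower_step M v : cs_seq C := fun n => if n == M then cs_map C n (v n.+1) else v n.

Fixpoint lower M v : cs_seq C := if M is M'.+1 then lower M' (lower_step M' v) else v.

(* The stable sequence in L_k that agrees with [v] at the indices n >= M.     *)
Definition extend k M v : cs_seq C :=
  fun n => if (n < maxn (cs_start C) k)%N then 0 else lower M v n.

Definition stable_from k d M v : Prop := forall n, (M <= n)%N ->
  (maxn (cs_start C) k <= n)%N ->
  [/\ Lspace (C n) k (v n), gcomp d (v n) & cs_map C n (v n.+1) = v n].

Lemma lowerE M v n : (M <= n)%N -> lower M v n = v n.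
Proof.
elim: M v => [//|M IH] v hn; rewrite [LHS]/= (IH _ (ltnW hn)) /lower_step.
by rewrite gtn_eqF.
Qed.

Lemma extend_lower k M v n : (maxn (cs_start C) k <= n)%N ->
  extend k M v n = lower M v n.
Proof. by move=> hn; rewrite /extend ifN // -leqNgt. Qed.

Lemma extendE k M v n : (M <= n)%N -> (maxn (cs_start C) k <= n)%N -> extend k M v n = v n.
Proof. by move=> hM hn; rewrite extend_lower // lowerE. Qed.

Lemma lower_stable k d M v : stable_from k d M v -> stable_from k d 0 (lower M v).
Proof.
elim: M v => //= M IH v hv; apply: IH => n; rewrite leq_eqVlt => /orP[/eqP<-|Mn] hM.
  have [hL hd e] : [/\ Lspace (C M.+1) k (v M.+1), gcomp d (v M.+1) &
      cs_map C M.+1 (v M.+2) = v M.+1] by apply: hv => //; apply: leqW.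
  have [hs hk] : (cs_start C <= M)%N /\ (k <= M)%N by apply/andP; rewrite -geq_max.
  rewrite /lower_step eqxx gtn_eqF //; split=> //; first exact: map_Lspace.
  exact: cs_map_deg.
rewrite /lower_step !gtn_eqF //; last exact: leqW.
exact: hv.
Qed.

Lemma extend_stable k d M v : stable_from k d M v -> stable_seq k d (extend k M v).
Proof.
move=> /lower_stable hv; split=> n hn; first by rewrite /extend hn.
1-3: by rewrite !extend_lower ?(leqW hn) //; have [] := hv n (leq0n n) hn.
Qed.

Lemma lower_linear M c v w n : lower M (c *: v + w) n = c *: lower M v n + lower M w n.
Proof.
elim: M v w => //= M IH v w; rewrite -IH; congr (lower M _ n).
apply: functional_extensionality_dep => m; rewrite /lower_step !(dprodDE, dprodZE).
by case: eqP => // _; rewrite linearP.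
Qed.

Lemma extend_linear k M c v w : extend k M (c *: v + w) = c *: extend k M v + extend k M w.
Proof.
apply: functional_extensionality_dep => n; rewrite dprodDE dprodZE /extend.
by case: ifP => _; rewrite ?scaler0 ?addr0 // lower_linear.
Qed.

Lemma extend0 k M : extend k M 0 = 0.
Proof. by have := extend_linear k M (-1) 0 0; rewrite scaler0 addr0 scaleN1r addNr. Qed.

Lemma stable_frakLk k d v : stable_seq k d v -> frakLk k v.
Proof.
move=> hv; exists d.+1, (fun e => if e == d then v else 0); split=> [e|].
  by case: eqP => [->|_] //; exact: stable_seq0.
by rewrite -big_mkcond /= (big_pred1 (ord_max : 'I_d.+1)).
Qed.

Lemma frakLk_sum k N (w : nat -> cs_seq C) :
  (forall d, frakLk k (w d)) -> frakLk k (\sum_(d < N) w d).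
Proof.
move=> hw; elim/big_ind: _ => [|x y hx hy|i _]; [exact: frakLk0| |exact: hw].
by rewrite -[x]scale1r; apply: frakLkP.
Qed.

Lemma frakLk_Lspace k v n : (cs_start C <= n)%N -> (k <= n)%N -> frakLk k v ->
  Lspace (C n) k (v n).
Proof.
move=> hs hk [N [w [hw ->]]]; rewrite dprod_sumE.
elim/big_ind: _ => [|x y hx hy|i _]; first exact: Lspace0.
  have [[a ->] [b ->]] := (hx, hy); exists (a + b).
  by rewrite -[a]scale1r ga_linr !scale1r.
by have [_ hL _ _] := hw i; apply: hL; rewrite geq_max hs.
Qed.

Lemma frakLk_small k v n : (n < maxn (cs_start C) k)%N -> frakLk k v -> v n = 0.
Proof.
move=> hn [N [w [hw ->]]]; rewrite dprod_sumE big1 // => i _.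
by have [h0 _ _ _] := hw i; apply: h0.
Qed.

Lemma frakLk_stable k v n : (maxn (cs_start C) k <= n)%N -> frakLk k v ->
  cs_map C n (v n.+1) = v n.
Proof.
move=> hn [N [w [hw ->]]]; rewrite !dprod_sumE linear_sum; apply: eq_bigr => i _.
by have [_ _ _] := hw i; apply.
Qed.

Lemma frakLk_ext k M v w : frakLk k v -> frakLk k w ->
  (forall n, (M <= n)%N -> v n = w n) -> v = w.
Proof.
move=> hv hw; elim: M => [|M IH] e.
  by apply: functional_extensionality_dep => n; apply: e.
apply: IH => n; rewrite leq_eqVlt => /orP[/eqP<-|]; last exact: e.
case: (ltnP M (maxn (cs_start C) k)) => hM; first by rewrite !(frakLk_small hM).
by rewrite -(frakLk_stable hM hv) -(frakLk_stable hM hw) e.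
Qed.

Lemma frakL_valD (x y : frakL_car C) : frakL_val (x + y) = frakL_val x + frakL_val y.
Proof. exact: (raddfD (\val : frakL_car C -> cs_seqs C)). Qed.

Lemma frakL_valN (x : frakL_car C) : frakL_val (- x) = - frakL_val x.
Proof. exact: (raddfN (\val : frakL_car C -> cs_seqs C)). Qed.

Lemma frakL_valZ c (x : frakL_car C) : frakL_val (c *: x) = c *: frakL_val x.
Proof. by rewrite -[c *: x]addr0 frakL_valDZ frakL_val0 addr0. Qed.

Lemma frakL_frakLk (x : frakL C) k : frakLk k (frakL_val x k).
Proof. by have /asboolP[] := frakL_valP x. Qed.

Lemma frakL_ext M (x y : frakL C) : (forall n k, (M <= n)%N -> (cs_start C <= n)%N ->
  frakL_val x k n = frakL_val y k n) -> x = y.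
Proof.
move=> e; apply: val_inj; apply: functional_extensionality_dep => k.
apply: (@frakLk_ext k M); try exact: frakL_frakLk.
move=> n Mn; case: (leqP (cs_start C) n) => hn; first exact: e.
by rewrite !(@frakLk_small k) ?leq_max ?hn //; exact: frakL_frakLk.
Qed.

End StableExtension.

(** * The action of B on the stable limit *)

Section StableLimitAction.
Variables (K : fieldType) (q t : K) (C : compseq q t).
Hypotheses (hq : transcendental q) (t0 : t != 0).
Local Notation E := (expr K false bgen).
Implicit Types (g : bgen) (r a b : E) (x y : frakL C).

Definition bgen_level g : nat :=
  match g with Be k | BT k _ | Bz k _ => k | Bdp k | Bdm k => k.+1 end.

Lemma bgen_uptoE N g : bgen_upto N g = (bgen_level g <= N)%N.
Proof. by case: g. Qed.

(** For n below [bgen_level g] the generator leaves the vertices 0, ..., n, so those entries come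
    from [extend]. *)
Definition gen_val g (u : cs_seqs C) : cs_seqs C :=
  fun k => extend k (bgen_level g) (fun n => Lgen g (fun j => u j n) k).

Lemma gen_val_linear g c (u v : cs_seqs C) :
  gen_val g (c *: u + v) = c *: gen_val g u + gen_val g v.
Proof.
apply: functional_extensionality_dep => k; rewrite dprodDE dprodZE -extend_linear.
congr (extend _ _ _); apply: functional_extensionality_dep => n.
by rewrite dprodDE dprodZE -Lgen_linear.
Qed.

Lemma gen_val_sum g N (w : nat -> cs_seqs C) :
  gen_val g (\sum_(d < N) w d) = \sum_(d < N) gen_val g (w d).
Proof.
have g0 : gen_val g 0 = 0.
  by have := gen_val_linear g (-1) 0 0; rewrite scaler0 addr0 scaleN1r addNr.
elim: N => [|N IH]; first by rewrite !big_ord0.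
rewrite !big_ord_recr /= -IH -[\sum_(i < N) w i]scale1r gen_val_linear.
by rewrite !scale1r.
Qed.

Lemma gen_val_stable g d (u : cs_seqs C) : (forall k, stable_seq k d (u k)) ->
  forall k, stable_seq k (bdeg g + d) (gen_val g u k).
Proof.
move=> hu k; apply: (extend_stable hq) => n gn hn.
have sn : (cs_start C <= n)%N by apply: leq_trans hn; exact: leq_maxl.
have mx m j : (n <= m)%N -> (j <= m)%N -> (maxn (cs_start C) j <= m)%N.
  by move=> nm jm; rewrite geq_max jm (leq_trans sn).
have hL m : (n <= m)%N -> forall j, (j <= m)%N -> Lspace (C m) j (u j m).
  by move=> nm j jm; have [_ h _ _] := hu j; apply/h/mx.
have hd j : (j <= n)%N -> gcomp d (u j n).
  by move=> jn; have [_ _ h _] := hu j; apply/h/mx.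
rewrite -bgen_uptoE in gn; split.
- by apply: Lgen_Lspace => //; exact: hL.
- exact: Lgen_deg.
- apply: (map_Lgen hq) => // j jn; first by apply: hL => //; apply: leqW.
  by have [_ _ _] := hu j; apply; apply: mx.
Qed.

Lemma gen_val_frakL g x : frakLb (gen_val g (frakL_val x)).
Proof.
(* [gen_val_stable] concerns homogeneous elements, hence the decomposition of x. *)
have [N [w [hw ->]]] := frakL_deg_sum x; rewrite frakL_val_sum.
rewrite (gen_val_sum g N (fun d => frakL_val (w d))).
apply/asboolP; split=> [k|].
  rewrite dprod_sumE; apply: (@frakLk_sum _ _ _ _ k N (fun d => gen_val g (frakL_val (w d)) k)).
  by move=> d; apply: stable_frakLk; apply: gen_val_stable; exact: hw.
exists (bgen_level g).+1 => k hk; rewrite dprod_sumE big1 // => i _.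
rewrite /gen_val -(extend0 C k (bgen_level g)); congr (extend _ _ _).
apply: functional_extensionality_dep => n.
by apply: (@Lgen_above _ _ _ _ _ (bgen_level g)) hk; rewrite bgen_uptoE.
Qed.

Definition gen_act g x : frakL C := FrakL (gen_val_frakL g x).

Lemma gen_act_linear g c x y : gen_act g (c *: x + y) = c *: gen_act g x + gen_act g y.
Proof. apply: val_inj; apply: etrans _ (esym (frakL_valDZ _ _ _)).
by rewrite -[LHS]/(gen_val g (frakL_val (c *: x + y))) frakL_valDZ gen_val_linear. Qed.

Fixpoint expr_act (r : E) (x : frakL C) : frakL C :=
  match r with
  | EGen g => gen_act g x
  | EZero => 0
  | EOne _ => x
  | EOpp a => - expr_act a x
  | EAdd a b => expr_act a x + expr_act b x
  | EScale c a => c *: expr_act a x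
  | EMul a b => expr_act a (expr_act b x)
  end.

Lemma expr_act_linear r c x y :
  expr_act r (c *: x + y) = c *: expr_act r x + expr_act r y.
Proof.
elim: r x y => //= [g||a IH|a IHa b IHb|e a IH|a IHa b IHb] x y.
- exact: gen_act_linear.
- by rewrite scaler0 addr0.
- by rewrite IH opprD scalerN.
- by rewrite IHa IHb scalerDr addrACA.
- by rewrite IH scalerDr !scalerA [c * _]mulrC.
- by rewrite IHb IHa.
Qed.

Lemma expr_act_val N r x n k : bexpr_upto N r -> (N <= n)%N -> (cs_start C <= n)%N ->
  frakL_val (expr_act r x) k n = Lact r (fun j => frakL_val x j n) k.
Proof.
move=> + Nn sn; elim: r x k => [g||[]|a IH|a IHa b IHb|c a IH|a IHa b IHb] x k //=.
- rewrite bgen_uptoE => gN; have gn := leq_trans gN Nn.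
  case: (leqP k n) => kn; first by rewrite /gen_val extendE // geq_max sn.
  (* For k > n both sides vanish. *)
  rewrite (@Lgen_above _ _ _ _ _ n) ?bgen_uptoE // (frakLk_small (k := k)) ?leq_max ?kn ?orbT //.
  exact: (frakL_frakLk (gen_act g x)).
- by move=> h; rewrite -IH // frakL_valN.
- by move=> /andP[ha hb]; rewrite -IHa // -IHb // frakL_valD.
- by move=> h; rewrite -IH // frakL_valZ.
- move=> /andP[ha hb]; rewrite IHa //; congr (Lact a _ k).
  by apply/funext => j; rewrite IHb.
Qed.

Fixpoint expr_level (r : E) : nat :=
  match r with
  | EGen g => bgen_level g
  | EZero | EOne _ => 0
  | EOpp a | EScale _ a => expr_level a
  | EAdd a b | EMul a b => maxn (expr_level a) (expr_level b)
  end.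

Lemma bexpr_uptoE N r : bexpr_upto N r = (expr_level r <= N)%N.
Proof.
by elim: r => //= [g|a IHa b IHb|a IHa b IHb]; rewrite ?bgen_uptoE ?geq_max ?IHa ?IHb.
Qed.

(** Beyond the levels of both sides the entries agree by [Lact_rel], and they determine the
    element. *)
Lemma expr_act_rel a b x : brel q t a b -> expr_act a x = expr_act b x.
Proof.
move=> r; apply: (@frakL_ext _ _ _ _ (maxn (expr_level a) (expr_level b))) => n k.
rewrite geq_max -!bexpr_uptoE => /andP[ha hb] hn.
rewrite !(expr_act_val (N := n)) //; congr (_ k); apply: (Lact_rel hq t0 r) => // j jn.
by apply: frakLk_Lspace => //; exact: frakL_frakLk.
Qed.

Lemma expr_act0 r : expr_act r 0 = 0.
Proof. by have := expr_act_linear r (-1) 0 0; rewrite scaler0 addr0 scaleN1r addNr. Qed.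

Lemma expr_actZ r c x : expr_act r (c *: x) = c *: expr_act r x.
Proof. by rewrite -[c *: x]addr0 expr_act_linear expr_act0 addr0. Qed.

Lemma expr_actD r x y : expr_act r (x + y) = expr_act r x + expr_act r y.
Proof. by rewrite -[x]scale1r expr_act_linear !scale1r. Qed.

Lemma expr_act_pcong a b x : @pcong K (Bqt q t) a b -> expr_act a x = expr_act b x.
Proof.
move=> h; elim: h x => {a b} //=; try by [move=> *; congruence | case].
- by move=> a b h x; exact: expr_act_rel h.
- by move=> a b c x; rewrite addrA.
- by move=> a b x; rewrite addrC.
- by move=> a x; rewrite add0r.
- by move=> a x; rewrite addNr.
- by move=> k l a x; rewrite scalerA.
- by move=> a x; rewrite scale1r.
- by move=> k a b x; rewrite scalerDr.
- by move=> k l a x; rewrite scalerDl.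
- by move=> a b c x; rewrite expr_actD.
- by move=> k a b x; rewrite expr_actZ.
Qed.

Definition Bqt_act (a : palg (Bqt q t)) x : frakL C := expr_act (prep a) x.

Lemma Bqt_act_pcl r x : Bqt_act (@pcl K (Bqt q t) r) x = expr_act r x.
Proof. by apply: expr_act_pcong; apply: prep_pcl. Qed.

Lemma gen_act_deg g d x : frakL_deg d x -> frakL_deg (bdeg g + d) (gen_act g x).
Proof. by move=> hx k; apply: gen_val_stable. Qed.

Lemma expr_act_deg c r d x : @ehomog K (Bqt q t) c r -> frakL_deg d x ->
  frakL_deg (c + d) (expr_act r x).
Proof.
have degZ e k y : frakL_deg e y -> frakL_deg e (k *: y).
  by move=> hy; rewrite -[_ *: y]addr0; apply: frakL_degP => //; exact: frakL_deg0.
move=> h; elim: h d x => {c r} //=.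
- by move=> g d x; apply: gen_act_deg.
- by move=> d e x _; exact: frakL_deg0.
- by move=> d a _ IH e x hx; rewrite -scaleN1r; apply/degZ/IH.
- by move=> d a b _ IHa _ IHb e x hx; rewrite -[expr_act a x]scale1r;
    apply: frakL_degP; [exact: IHa | exact: IHb].
- by move=> d k a _ IH e x hx; apply/degZ/IH.
- by move=> c d a b _ IHa _ IHb e x hx; rewrite -addnA; apply/IHa/IHb.
Qed.

Lemma Bqt_act_linl x (c : K) (a b : palg (Bqt q t)) :
  Bqt_act (c *: a + b) x = c *: Bqt_act a x + Bqt_act b x.
Proof.
have [[e ->] [f ->]] := (pcl_surj a, pcl_surj b).
by rewrite -pclZ -pclD !Bqt_act_pcl.
Qed.

Lemma Bqt_act_mul (a b : palg (Bqt q t)) x : Bqt_act (pmul a b) x = Bqt_act a (Bqt_act b x).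
Proof.
have [[e ->] [f ->]] := (pcl_surj a, pcl_surj b).
by rewrite -pcl_mul !Bqt_act_pcl.
Qed.

Lemma Bqt_act_one (h : punital (Bqt q t)) x : Bqt_act (pone h) x = x.
Proof. by []. Qed.

Lemma Bqt_act_deg c (e : expr K (punital (Bqt q t)) (pgen (Bqt q t))) d (x : frakL C) :
  ehomog c e -> gcomp d x -> gcomp (c + d) (Bqt_act (pcl e) x).
Proof. by rewrite Bqt_act_pcl; apply: expr_act_deg. Qed.

Definition frakL_action : gaction (Bqt q t) (frakL C) :=
  @GAction K (Bqt q t) (frakL C) Bqt_act Bqt_act_linl
    (fun u => expr_act_linear (prep u)) Bqt_act_mul Bqt_act_one Bqt_act_deg.

Lemma frakL_action_stable : stable_limit_action frakL_action.
Proof.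
by move=> N r x n k hr Nn sn; rewrite /= Bqt_act_pcl (expr_act_val _ _ hr).
Qed.

End StableLimitAction.

(** * Morphisms induced on stable limits *)

Section InducedMorphism.
Variables (K : fieldType) (q t : K) (C D : compseq q t).
Hypotheses (hq : transcendental q) (t0 : t != 0).
Variable phi : cs_hom C D.
Implicit Types (x : frakL C) (n k : nat).

Definition hom_val (u : cs_seqs C) : cs_seqs D :=
  fun k => extend k (csh_start phi) (fun n => phi n (u k n)).

Lemma hom_val_linear c (u v : cs_seqs C) :
  hom_val (c *: u + v) = c *: hom_val u + hom_val v.
Proof.
apply: functional_extensionality_dep => k; rewrite dprodDE dprodZE -extend_linear.
congr (extend _ _ _); apply: functional_extensionality_dep => n.
by rewrite !(dprodDE, dprodZE) linearP.
Qed.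

Lemma hom_val_sum N (w : nat -> cs_seqs C) :
  hom_val (\sum_(d < N) w d) = \sum_(d < N) hom_val (w d).
Proof.
have h0 : hom_val 0 = 0.
  by have := hom_val_linear (-1) 0 0; rewrite scaler0 addr0 scaleN1r addNr.
elim: N => [|N IH]; first by rewrite !big_ord0.
rewrite !big_ord_recr /= -IH -[\sum_(i < N) w i]scale1r hom_val_linear.
by rewrite !scale1r.
Qed.

Lemma csh_start_le n : (csh_start phi <= n)%N ->
  (cs_start C <= n)%N /\ (cs_start D <= n)%N.
Proof.
move=> hn; apply/andP; rewrite -geq_max; exact: leq_trans (csh_startP phi) hn.
Qed.

Lemma hom_val_stable d (u : cs_seqs C) : (forall k, stable_seq k d (u k)) ->
  forall k, stable_seq k d (hom_val u k).
Proof.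
move=> hu k; apply: (extend_stable hq) => n pn hn.
have [sC sD] := csh_start_le pn.
have mx : (maxn (cs_start C) k <= n)%N.
  by move: hn; rewrite !geq_max => /andP[_ ->]; rewrite sC.
have [_ hL hd hs] := hu k; split.
- have [v ->] := hL n mx; rewrite csh_act //; eexists; reflexivity.
- by apply: csh_deg => //; apply: hd.
- by rewrite -csh_map // hs.
Qed.

Lemma hom_val_frakL x : frakLb (hom_val (frakL_val x)).
Proof.
have [N [w [hw e]]] := frakL_deg_sum x; have /asboolP [_ [M hM]] := frakL_valP x.
apply/asboolP; split=> [k|].
  rewrite e frakL_val_sum (hom_val_sum N (fun d => frakL_val (w d))) dprod_sumE.
  apply: (@frakLk_sum _ _ _ _ k N (fun d => hom_val (frakL_val (w d)) k)) => d.
  by apply: stable_frakLk; apply: hom_val_stable; exact: hw.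
exists M => k hk; rewrite /hom_val -(extend0 D k (csh_start phi)); congr (extend _ _ _).
by apply: functional_extensionality_dep => n; rewrite hM // linear0.
Qed.

Definition frakL_hom x : frakL D := FrakL (hom_val_frakL x).

Lemma frakL_hom_val x n k : (csh_start phi <= n)%N ->
  frakL_val (frakL_hom x) k n = phi n (frakL_val x k n).
Proof.
move=> hn; have [sC sD] := csh_start_le hn.
case: (leqP k n) => kn; first by rewrite /= /hom_val extendE // geq_max sD.
rewrite !(frakLk_small (k := k)) ?leq_max ?kn ?orbT ?linear0 //.
  exact: frakL_frakLk.
exact: (frakL_frakLk (frakL_hom x)).
Qed.

Lemma frakL_hom_linear : linear frakL_hom.
Proof.
move=> c x y; apply: val_inj; apply: etrans _ (esym (frakL_valDZ _ _ _)).
by rewrite -[LHS]/(hom_val (frakL_val (c *: x + y))) frakL_valDZ hom_val_linear.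
Qed.
HB.instance Definition _ := GRing.isLinear.Build K (frakL C) (frakL D) _
  frakL_hom frakL_hom_linear.

Lemma frakL_hom_deg d x : gcomp d x -> gcomp d (frakL_hom x).
Proof. by move=> hx k; apply: hom_val_stable. Qed.

(** The formulas are built from operators of D_n^+, with which phi^(n) commutes. *)
Lemma csh_Lact n r (y : nat -> C n) k : (csh_start phi <= n)%N ->
  phi n (Lact r y k) = Lact r (fun j => phi n (y j)) k.
Proof.
move=> hn; have hdact e v : phi n (dact e v) = dact e (phi n v) by exact: csh_act.
have hsingle j (v : C n) w l : phi n v = w -> phi n (single j v l) = single j w l.
  by move=> <-; rewrite /single; case: eqP; rewrite ?linear0.
elim: r y k => [g||u|a IH|a IHa b IHb|c a IH|a IHa b IHb] y k /=.
- case: g => [j|j i|j i|j|j]; apply: hsingle => //; rewrite ?linearZ /= ?hdact //.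
  rewrite linear_sum; congr (_ *: _); apply: eq_bigr => i _.
  by rewrite linearZ /= hdact.
- exact: linear0.
- by [].
- by rewrite linearN IH.
- by rewrite linearD IHa IHb.
- by rewrite linearZ /= IH.
- by rewrite IHa; congr (Lact a _ k); apply/funext => j; rewrite IHb.
Qed.

Lemma frakL_hom_act (a : palg (Bqt q t)) x :
  frakL_hom (frakL_action C hq t0 a x) = frakL_action D hq t0 a (frakL_hom x).
Proof.
have [r ->] := pcl_surj a.
apply: (@frakL_ext _ _ _ _ (maxn (expr_level r) (csh_start phi))) => n k.
rewrite geq_max -bexpr_uptoE => /andP[hr hn] _; have [sC sD] := csh_start_le hn.
rewrite frakL_hom_val // (frakL_action_stable hq t0 _ _ hr) //.
rewrite (frakL_action_stable hq t0 _ _ hr) // csh_Lact //.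
by congr (Lact r _ k); apply/funext => j; rewrite frakL_hom_val.
Qed.

Definition frakL_gmod_hom :
  gmod_hom (GMod (frakL_action C hq t0)) (GMod (frakL_action D hq t0)) :=
  @GModHom K (Bqt q t) (GMod (frakL_action C hq t0)) (GMod (frakL_action D hq t0))
    frakL_hom frakL_hom_deg frakL_hom_act.

End InducedMorphism.

(** * The parameters q and t, and the functor *)

Lemma Qq_transcendental : transcendental Qq.
Proof.
move=> p p0; pose f : {rmorphism {poly rat} -> Qqt} := @tofrac {poly {poly rat}} \o polyC.
have -> : map_poly intr p = map_poly f (map_poly intr p).
  by rewrite -map_poly_comp; apply: eq_map_poly => z; exact: esym (rmorph_int f z).
rewrite -[Qq]/(f 'X) horner_map /= tofrac_eq0 polyC_eq0.
have -> : map_poly intr p = map_poly polyC (map_poly intr p : {poly rat}).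
  by rewrite -map_poly_comp; apply: eq_map_poly => z; exact: esym (rmorph_int polyC z).
(* Evaluating at the variable returns the polynomial, so p is recovered from its value. *)
rewrite -[_.['X]]/(_ \Po 'X) comp_polyXr.
apply: contraNneq p0 => e; apply/eqP.
by apply: (map_inj_poly (@intr_inj rat)); rewrite ?rmorph0.
Qed.

Lemma Qt_neq0 : Qt != 0.
Proof. by rewrite /Qt tofrac_eq0 polyX_eq0. Qed.

Theorem theorem3p12 :
  exists act : forall C : compseq Qq Qt, gaction (Bqt Qq Qt) (frakL C),
    (forall C : compseq Qq Qt, stable_limit_action (act C)) /\
    exists Fh : forall C D : compseq Qq Qt,
        cs_hom C D -> gmod_hom (GMod (act C)) (GMod (act D)),
      is_functor (A := cs_category Qq Qt) (B := gmod_category (Bqt Qq Qt))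
        (F := fun C => GMod (act C)) Fh /\
      (forall (C D : compseq Qq Qt) (phi : cs_hom C D) (x : frakL C) (k n : nat),
         (csh_start phi <= n)%N ->
         frakL_val (Fh C D phi x) k n = phi n (frakL_val x k n)).
Proof.
exists (fun C => frakL_action C Qq_transcendental Qt_neq0); split.
  by move=> C; apply: frakL_action_stable.
exists (fun C D phi => frakL_gmod_hom Qq_transcendental Qt_neq0 phi); split.
  (* Morphisms of compatible sequences are compared for large n, so each law is checked on entries
     past all starting indices. *)
  split.
  - move=> C D f g [N h] x; apply: (@frakL_ext _ _ _ _
        (maxn N (maxn (csh_start f) (csh_start g)))) => n k.
    rewrite !geq_max => /andP[Nn /andP[fn gn]] _.
    by rewrite !frakL_hom_val // h.
  - move=> C x; apply: (@frakL_ext _ _ _ _ (csh_start (cs_id C))) => n k hn _.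
    by rewrite frakL_hom_val.
  - move=> C D F g f x; apply: (@frakL_ext _ _ _ _ (csh_start (cs_comp g f))) => n k hn _.
    have /andP[fn gn] : (csh_start f <= n)%N && (csh_start g <= n)%N by rewrite -geq_max.
    apply: etrans (frakL_hom_val _ x k hn) _; symmetry.
    by apply: etrans (frakL_hom_val _ _ k gn) _; rewrite frakL_hom_val.
by move=> C D phi x k n; apply: frakL_hom_val.
Qed.
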